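(* Let $n\ge2$, $1<\mathscr{P}\le n-1$, $N=\binom{n}{\mathscr{P}}$, let $0\le l<k\le N$ be integers and $p,q$ constants with $p>q-l$. Let $\varphi\in C^1(\mathbb{S}^n)$ be positive and let $u\in C^3(\mathbb{S}^n)$ be a positive admissible solution of $$\frac{\sigma_k(\Lambda(\nabla^2u+uI))}{\sigma_l(\Lambda(\nabla^2u+uI))}=u^{p-1}(u^2+|\nabla u|^2)^{\frac{k+1-q}{2}}\varphi\quad\text{on }\mathbb{S}^n.$$ Then for all $x\in\mathbb{S}^n$, $$\frac{|\nabla u(x)|}{u(x)}\le\frac{1}{p-q+l}\max_{\mathbb{S}^n}\frac{|\nabla\varphi|}{\varphi}.$$
   Context: $\mathbb{S}^n$ is the unit sphere with its standard metric; $\nabla u$, $\nabla^2u$ are the gradient and covariant Hessian in a local orthonormal frame; $I$ is the identity. Let $\mathbf{I}_1,\dots,\mathbf{I}_N$ enumerate the multi-indices $1\le i_1<\dots<i_{\mathscr{P}}\le n$. For a symmetric matrix $A$ with eigenvalues $\lambda$, $\Lambda(A)=(\Lambda_{\mathbf{I}_1},\dots,\Lambda_{\mathbf{I}_N})$ with $\Lambda_{\mathbf{I}}=\lambda_{i_1}+\dots+\lambda_{i_{\mathscr{P}}}$. $\sigma_m$ is the $m$-th elementary symmetric polynomial, $\sigma_0=1$; $\Gamma_k=\{\mu\in\mathbb{R}^N:\sigma_j(\mu)>0,\ 1\le j\le k\}$. A function $u\in C^2(\mathbb{S}^n)$ is admissible if $\Lambda(\nabla^2u+uI)\in\Gamma_k$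 at every point. *)

(* Defs.v *)
From HB Require Import structures.
From mathcomp Require Import all_boot all_order all_algebra.
From mathcomp Require Import all_classical all_reals all_analysis.
Set Implicit Arguments. Unset Strict Implicit. Unset Printing Implicit Defensive.
Import Order.TTheory GRing.Theory Num.Theory.
Import numFieldNormedType.Exports.
Local Open Scope ring_scope.
Local Open Scope classical_set_scope.

Section Defs.
Variable R : realType.

Definition edot m (x y : 'rV[R]_m) : R := \sum_(i < m) x 0 i * y 0 i.
Definition enorm m (x : 'rV[R]_m) : R := Num.sqrt (edot x x).

Definition ev m (i : 'I_m) : 'rV[R]_m := \row_(j < m) (i == j)%:R.

Definition pd m (f : 'rV[R]_m -> R) (i : 'I_m) : 'rV[R]_m -> R :=
  fun y => 'D_(ev i) f y.

Fixpoint Ck m (k : nat) (D : set 'rV[R]_m) (f : 'rV[R]_m -> R) : Prop :=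
  match k with
  | 0 => forall y, D y -> {for y, continuous f}
  | k'.+1 => (forall y, D y -> {for y, continuous f}) /\
             forall i : 'I_m, (forall y, D y -> derivable f y (ev i)) /\
                              Ck k' D (pd f i)
  end.

Definition sphere n : set 'rV[R]_n.+1 := [set x | enorm x = 1].
Definition punctured n : set 'rV[R]_n.+1 := [set y | y != 0].

Definition hom0 n (f : 'rV[R]_n.+1 -> R) : 'rV[R]_n.+1 -> R :=
  fun y => f ((enorm y)^-1 *: y).

Definition CkS n (k : nat) (f : 'rV[R]_n.+1 -> R) : Prop :=
  Ck k (@punctured n) (hom0 f).

(* Euclidean gradient of the extension at x; at x in S^n this is the
   spherical gradient (tangent vector) of f. *)
Definition sgrad n (f : 'rV[R]_n.+1 -> R) (x : 'rV[R]_n.+1) : 'rV[R]_n.+1 :=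
  \row_(i < n.+1) pd (hom0 f) i x.

Definition sgradnorm n (f : 'rV[R]_n.+1 -> R) (x : 'rV[R]_n.+1) : R :=
  enorm (sgrad f x).

Definition ahess n (f : 'rV[R]_n.+1 -> R) (x : 'rV[R]_n.+1) : 'M[R]_n.+1 :=
  \matrix_(i < n.+1, j < n.+1) pd (pd (hom0 f) j) i x.

Definition tframe n (x : 'rV[R]_n.+1) (E : 'M[R]_(n.+1, n)) : Prop :=
  E^T *m E = 1%:M /\ x *m E = 0.

(* covariant Hessian of f on S^n in the frame E (Gauss formula:
   nabla^2 f(X,Y) = D^2 F(X,Y) - <DF, x> <X,Y> for any extension F) *)
Definition shess n (f : 'rV[R]_n.+1 -> R) (x : 'rV[R]_n.+1)
    (E : 'M[R]_(n.+1, n)) : 'M[R]_n :=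
  E^T *m ahess f x *m E - (edot (sgrad f x) x)%:M.

Definition sW n (u : 'rV[R]_n.+1 -> R) x E : 'M[R]_n :=
  shess u x E + (u x)%:M.

Definition eigen_list n (A : 'M[R]_n) (lam : 'I_n -> R) : Prop :=
  char_poly A = \prod_(i < n) ('X - (lam i)%:P).

Definition sigma (T : finType) (m : nat) (mu : T -> R) : R :=
  \sum_(A : {set T} | #|A| == m) \prod_(i in A) mu i.

(* Lambda(lam): the vector (Lambda_I)_I indexed by the P-subsets
   I = {i_1 < ... < i_P} of {1..n} (there are N = 'C(n,P) of them),
   Lambda_I = lam_{i_1} + ... + lam_{i_P}. *)
Definition Psubsets n (P : nat) := {I : {set 'I_n} | #|I| == P}.
Definition Lambda n (P : nat) (lam : 'I_n -> R) : Psubsets n P -> R :=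
  fun I => \sum_(i in val I) lam i.

Definition sigmaLambda n (P m : nat) (lam : 'I_n -> R) : R :=
  sigma m (@Lambda n P lam).

Definition inGammaLambda n (P k : nat) (lam : 'I_n -> R) : Prop :=
  forall j : nat, (1 <= j <= k)%N -> 0 < sigmaLambda P j lam.

End Defs.

(* Main.v *)
Require Import Defs.
From HB Require Import structures.
From mathcomp Require Import all_boot all_order all_algebra.
From mathcomp Require Import all_classical all_reals all_analysis.
From mathcomp Require Import perm zify ring lra complex.
Set Implicit Arguments. Unset Strict Implicit. Unset Printing Implicit Defensive.
Import Order.TTheory GRing.Theory Num.Theory.
Import numFieldNormedType.Exports.
Local Open Scope ring_scope.

(** Maximum principle for [psi = |grad log u|^2].  Let [U] be the
    0-homogeneous extension of [u] and [V_i = d_i U / U], so that at a point of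
    the sphere the matrix of the equation is [u (E^T (DV + V V^T) E + 1)] and
    the equation becomes [F = u^(p-q+l) (1 + psi)^((k+1-q)/2) phi], with [F]
    the quotient of elementary symmetric functions evaluated on [Lambda] of
    [A = E^T (DV + V V^T) E + 1].  At a maximum point of [psi] move along the
    great circle in the direction of the gradient, rotating the frame with the
    point: the first and second order conditions at the maximum give
    [A' <= 0] as a quadratic form.  Hence [A(t) <= A(0) + eps t] for small
    [t > 0], and Weyl's monotonicity of eigenvalues together with the
    monotonicity of [sigma_k / sigma_l] on [Gamma_k] shows that the logarithmic
    derivative of the right-hand side, [(p-q+l) |grad log u| + d_e phi / phi],
    is nonpositive.  No derivative of [F] with respect to the matrix is needed.

    Monotonicity of [sigma_k / sigma_l] follows from the Marcus--Lopes recursion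
    for [sigma_(m+1) / sigma_m]; the inclusion of the deleted vector in
    [Gamma_(k-1)] uses the weak Newton inequality
    [sigma_(m-1) sigma_(m+1) <= sigma_m^2], valid for all real vectors. *)

(** * Elementary symmetric functions on the cone Gamma_k *)

Section ElementarySymmetric.
Context {R : realType} {T : finType}.
Implicit Types (x y : T -> R) (i : T).

(* Deleting the variable [i] is encoded by giving it the value [0]. *)
Definition zero_at x i : T -> R := fun j => if j == i then 0 else x j.

Lemma sigma0 x : sigma 0 x = 1.
Proof.
rewrite /sigma (bigD1 finset.set0) ?cards0//= big_set0 big1 ?addr0// => A.
by rewrite cards_eq0 => /andP[/eqP->]; rewrite eqxx.
Qed.

Lemma sigma_zero_at m x i :
  sigma m (zero_at x i) =
  \sum_(A : {set T} | (#|A| == m) && (i \notin A)) \prod_(j in A) x j.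
Proof.
rewrite /sigma (bigID (fun A : {set T} => i \in A))/= big1 ?add0r; last first.
  by move=> A /andP[_ iA]; rewrite (bigD1 i)//= /zero_at eqxx mul0r.
apply: eq_bigr => A /andP[_ iA]; apply: eq_bigr => j jA.
by rewrite /zero_at; case: eqP => // ji; rewrite -ji jA in iA.
Qed.

Lemma mul_sigma_zero_at m x i :
  x i * sigma m (zero_at x i) =
  \sum_(A : {set T} | (#|A| == m.+1) && (i \in A)) \prod_(j in A) x j.
Proof.
rewrite sigma_zero_at mulr_sumr.
rewrite [RHS](reindex_onto (fun A => i |: A)%SET (fun A => A :\ i)%SET)/=; last first.
  by move=> A /andP[_ iA]; rewrite finset.setD1K.
apply: eq_big => [A|A /andP[_ iA]]; last by rewrite big_setU1.
rewrite finset.setU11 andbT cardsU1.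
case: (boolP (i \in A)) => iA /=; rewrite ?andbF ?andbT.
  apply/esym/negbTE/negP => /andP[_ /eqP AE].
  by have := iA; rewrite -AE !inE eqxx.
by rewrite add1n eqSS finset.setU1K// eqxx andbT.
Qed.

Lemma sigmaS m x i :
  sigma m.+1 x = sigma m.+1 (zero_at x i) + x i * sigma m (zero_at x i).
Proof.
rewrite mul_sigma_zero_at sigma_zero_at addrC.
by rewrite {1}/sigma (bigID (fun A : {set T} => i \in A)).
Qed.

(** Double counting: a set of [m.+1] indices occurs once for each of its elements. This is Euler's
    identity, [sigma m (zero_at x i)] being the partial derivative of [sigma m.+1] in the variable
    [i]. *)
Lemma sum_mul_sigma_zero_at m x :
  \sum_i x i * sigma m (zero_at x i) = m.+1%:R * sigma m.+1 x.
Proof.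
under eq_bigr do rewrite mul_sigma_zero_at big_mkcond/=.
rewrite exchange_big/= /sigma mulr_sumr [RHS]big_mkcond/=.
apply: eq_bigr => A _; case: eqP => [Am|_]; last by rewrite big1.
rewrite -big_mkcond/= big_const -[LHS]/(iter _ _ _) Am.
by rewrite iter_addr_0 mulr_natl.
Qed.

(* Summing [sigmaS] against [x i * _] expresses both products below through
   the sums of squares [x i ^+ 2], and the mixed terms cancel. *)
Lemma sigma_newton_recurrence m x :
  m.+1%:R * sigma m.+1 x ^+ 2 - m.+2%:R * (sigma m x * sigma m.+2 x) =
  \sum_i x i ^+ 2 * (sigma m (zero_at x i) ^+ 2 -
     (if m is m'.+1 then sigma m' (zero_at x i) else 0)
       * sigma m.+1 (zero_at x i)).
Proof.
have -> : m.+1%:R * sigma m.+1 x ^+ 2 - m.+2%:R * (sigma m x * sigma m.+2 x) =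
  (\sum_i x i * sigma m (zero_at x i)) * sigma m.+1 x
  - sigma m x * (\sum_i x i * sigma m.+1 (zero_at x i)).
  by rewrite !sum_mul_sigma_zero_at; ring.
rewrite mulr_suml mulr_sumr -sumrB; apply: eq_bigr => i _.
rewrite (sigmaS m x i); case: m => [|m]; first by rewrite !sigma0; ring.
rewrite (sigmaS m x i); ring.
Qed.

(** The induction hypothesis at the deleted vectors makes the right side of
    [sigma_newton_recurrence] nonnegative. Hence (m+1) sigma_(m+1)^2 >= (m+2) sigma_m sigma_(m+2),
    which suffices if the product on the right is positive; otherwise the claim is trivial. *)
Lemma sigma_newton m x : sigma m x * sigma m.+2 x <= sigma m.+1 x ^+ 2.
Proof.
elim: m x => [|m IH] x; rewrite real_leNgt ?num_real//; apply/negP => lt.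
  have := sigma_newton_recurrence 0 x; have : 0 <= sigma 1 x ^+ 2 by exact: sqr_ge0.
  have : 0 <= \sum_i x i ^+ 2 * (sigma 0 (zero_at x i) ^+ 2 - 0 * sigma 1 (zero_at x i)).
    by apply: sumr_ge0 => i _; rewrite mul0r subr0 mulr_ge0 ?sqr_ge0.
  by move: lt; rewrite sigma0 => ? ? ? /= E; lra.
have S0 : 0 <= \sum_i x i ^+ 2 * (sigma m.+1 (zero_at x i) ^+ 2 -
    sigma m (zero_at x i) * sigma m.+2 (zero_at x i)).
  by apply: sumr_ge0 => i _; rewrite mulr_ge0 ?sqr_ge0// subr_ge0.
have := sigma_newton_recurrence m.+1 x => /= E; rewrite -E in S0.
have sq0 : 0 <= sigma m.+2 x ^+ 2 by exact: sqr_ge0.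
have : m.+2%:R * sigma m.+2 x ^+ 2 < m.+2%:R * (sigma m.+1 x * sigma m.+3 x).
  by rewrite ltr_pM2l.
move: S0; rewrite -[m.+3%:R]natr1; lra.
Qed.

Definition Gamma k x : Prop := forall j, (1 <= j <= k)%N -> 0 < sigma j x.

Lemma Gamma_le k k' x : (k' <= k)%N -> Gamma k x -> Gamma k' x.
Proof.
move=> le G j /andP[j1 jk]; apply: G; rewrite j1; exact: leq_trans jk le.
Qed.

Lemma Gamma_sigma_gt0 k x j : Gamma k x -> (j <= k)%N -> 0 < sigma j x.
Proof.
by move=> G; case: j => [_|j jk]; [rewrite sigma0 | apply: G; rewrite jk].
Qed.

(** Strong induction on the order. Let a, b, c be three consecutive sigma's of the deleted vector
    and t = [x i]. If b <= 0 < a, positivity of b + t a and c + t b gives a c > - t a b >= b^2,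
    against [sigma_newton]. Using the order of c costs one level of the cone. *)
Lemma Gamma_zero_at k x i : Gamma k.+1 x -> Gamma k (zero_at x i).
Proof.
move=> G j /andP[_]; elim/ltn_ind: j => -[|j] IH jk; first by rewrite sigma0.
have s0 : 0 < sigma j (zero_at x i).
  by case: j IH jk => [|j] IH jk; [rewrite sigma0 | apply: IH => //; exact: ltnW].
rewrite real_ltNge ?num_real//; apply/negP => le0.
have := Gamma_sigma_gt0 G (leqW jk); rewrite (sigmaS _ _ i).
have := Gamma_sigma_gt0 (j := j.+2) G jk; rewrite (sigmaS _ _ i).
have := sigma_newton j (zero_at x i).
set a := sigma j _ in s0 *; set b := sigma j.+1 _ in le0 *; set c := sigma j.+2 _.
set t := x i => N p2 p1.
have : 0 < a * (c + t * b) by rewrite mulr_gt0.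
have : 0 <= (b + t * a) * - b by rewrite mulr_ge0 ?oppr_ge0// ltW.
lra.
Qed.

Definition sigma_ratio m x : R := sigma m.+1 x / sigma m x.

(** First [q] is increased, then [a]. Each difference is a square times the increment over a product
    of denominators, so only the sums have to be positive; entries of a vector in the cone may be
    negative. *)
Lemma harmonic_le (a b q r : R) : a <= b -> q <= r -> 0 < a + q ->
  a * q / (a + q) <= b * r / (b + r).
Proof.
move=> ab qr aq; have ar : 0 < a + r by lra.
have br : 0 < b + r by lra.
apply: (@le_trans _ _ (a * r / (a + r))).
  rewrite -subr_ge0.
  have -> : a * r / (a + r) - a * q / (a + q) = a ^+ 2 * (r - q) / ((a + r) * (a + q)).
    by field; apply/andP; split; apply: lt0r_neq0.
  by apply: divr_ge0; apply: mulr_ge0; rewrite ?sqr_ge0 ?subr_ge0// ltW.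
rewrite -subr_ge0.
have -> : b * r / (b + r) - a * r / (a + r) = r ^+ 2 * (b - a) / ((b + r) * (a + r)).
  by field; apply/andP; split; apply: lt0r_neq0.
by apply: divr_ge0; apply: mulr_ge0; rewrite ?sqr_ge0 ?subr_ge0// ltW.
Qed.

(* The Marcus--Lopes recursion. *)
Lemma sigma_ratioS m x : Gamma m.+1 x ->
  m.+2%:R * sigma_ratio m.+1 x =
  \sum_i x i * sigma_ratio m (zero_at x i) / (x i + sigma_ratio m (zero_at x i)).
Proof.
move=> G; rewrite /sigma_ratio mulrA -sum_mul_sigma_zero_at mulr_suml.
apply: eq_bigr => i _.
have s0 := Gamma_sigma_gt0 (Gamma_zero_at i G) (leqnn m).
have s1 := Gamma_sigma_gt0 G (leqnn m.+1).
rewrite (sigmaS m x i) in s1 *; field.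
by rewrite (gt_eqF s0) addrC gt_eqF.
Qed.

Lemma sigma_ratio_denom_gt0 m x i : Gamma m.+1 x ->
  0 < x i + sigma_ratio m (zero_at x i).
Proof.
move=> G; have s0 := Gamma_sigma_gt0 (Gamma_zero_at i G) (leqnn m).
have s1 := Gamma_sigma_gt0 G (leqnn m.+1); rewrite (sigmaS m x i) in s1.
have -> : x i + sigma_ratio m (zero_at x i) =
  (sigma m.+1 (zero_at x i) + x i * sigma m (zero_at x i)) / sigma m (zero_at x i).
  by rewrite /sigma_ratio; field; rewrite gt_eqF.
by rewrite divr_gt0.
Qed.

Lemma zero_at_le x y i : (forall j, x j <= y j) ->
  forall j, zero_at x i j <= zero_at y i j.
Proof. by move=> xy j; rewrite /zero_at; case: eqP. Qed.

(** Both conclusions are proved together by induction on [k]. [sigma_ratioS] reduces the last ratio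
    to ratios of deleted vectors, which lie one cone lower, and [harmonic_le] compares the summands;
    the bound on the last ratio then puts [y] in the next cone. *)
Lemma sigma_ratio_mono k x y : Gamma k x -> (forall j, x j <= y j) ->
  Gamma k y /\ (forall m, (m < k)%N -> sigma_ratio m x <= sigma_ratio m y).
Proof.
elim: k x y => [|k IH] x y G xy.
  by split=> [j|//]; rewrite leqn0 => /andP[/gtn_eqF->].
have [Gy ry] := IH x y (Gamma_le (leqnSn k) G) xy.
have rk : sigma_ratio k x <= sigma_ratio k y.
  case: k IH G Gy {ry} => [|k] IH G Gy.
    rewrite /sigma_ratio !sigma0 !divr1.
    have s1 (z : T -> R) : sigma 1 z = \sum_i z i.
      have := sum_mul_sigma_zero_at 0 z; rewrite mul1r => <-.
      by apply: eq_bigr => i _; rewrite sigma0 mulr1.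
    by rewrite !s1; apply: ler_sum => i _.
  rewrite -(@ler_pM2l _ k.+2%:R)// sigma_ratioS; last exact: (Gamma_le (leqnSn _) G).
  rewrite sigma_ratioS//; apply: ler_sum => i _; apply: harmonic_le => //.
    have [_] := IH _ _ (Gamma_zero_at i G) (zero_at_le i xy); exact.
  exact: sigma_ratio_denom_gt0 (Gamma_le (leqnSn _) G).
have sky := Gamma_sigma_gt0 Gy (leqnn k).
split=> [j /andP[j1]|m].
  rewrite leq_eqVlt => /predU1P[->|jk]; last by apply: Gy; rewrite j1.
  have : 0 < sigma_ratio k y.
    apply: lt_le_trans rk; rewrite divr_gt0//; apply: (Gamma_sigma_gt0 G) => //.
  by rewrite /sigma_ratio pmulr_lgt0 ?invr_gt0.
by rewrite ltnS leq_eqVlt => /predU1P[->//|]; apply: ry.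
Qed.

(** The quotient telescopes into the product of the ratios sigma_(j+1) / sigma_j for l <= j < k,
    each positive and monotone. *)
Lemma sigma_quotient_mono k l x y : (l <= k)%N -> Gamma k x ->
  (forall j, x j <= y j) -> sigma k x / sigma l x <= sigma k y / sigma l y.
Proof.
move=> lk Gx xy; have [Gy ry] := sigma_ratio_mono Gx xy.
have s z m : Gamma k z -> (m <= k)%N -> sigma m z != 0.
  by move=> Gz mk; rewrite gt_eqF// (Gamma_sigma_gt0 Gz).
have E z : Gamma k z -> forall m, (l <= m <= k)%N ->
    sigma m z / sigma l z = \prod_(l <= j < m) sigma_ratio j z.
  move=> Gz; elim=> [|m IH] /andP[lm mk].
    by move: lm; rewrite leqn0 => /eqP->; rewrite big_geq// divff// s.
  move: lm; rewrite leq_eqVlt => /predU1P[->|lm]; first by rewrite big_geq// divff// s.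
  rewrite big_nat_recr//= -IH ?(ltnW mk) ?andbT// /sigma_ratio.
  by field; rewrite !s// ltnW.
rewrite !E ?lk ?leqnn//; rewrite !big_nat; apply: ler_prod => j /andP[_ jk].
by rewrite ry// andbT divr_ge0// ltW// (Gamma_sigma_gt0 Gx)// ltnW.
Qed.

Lemma sigmaZ m (c : R) x : sigma m (fun i => c * x i) = c ^+ m * sigma m x.
Proof.
rewrite /sigma mulr_sumr; apply: eq_bigr => A /eqP <-.
by rewrite big_split/= prodr_const.
Qed.

End ElementarySymmetric.

(** * Weyl monotonicity of eigenvalues *)

Section Sorting.
Context {R : realType} {n : nat}.
Implicit Types lam mu : 'I_n -> R.

Lemma perm_sort_fun lam :
  exists s : 'S_n, forall i j : 'I_n, (i <= j)%N -> lam (s j) <= lam (s i).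
Proof.
pose t := [tuple lam i | i < n].
have /tuple_permP[s ts] : perm_eq (sort >=%R t) t by rewrite perm_sort.
exists s => i j ij.
have st : sorted >=%R (sort >=%R t) by apply: sort_sorted => x y; exact: le_total.
have sz : size (sort >=%R t) = n by rewrite size_sort size_tuple.
have E k : nth 0 (sort >=%R t) (k : 'I_n) = lam (s k).
  by rewrite ts nth_mktuple tnth_mktuple.
have tr : transitive (>=%R : rel R) by move=> x y z xy yz; exact: le_trans yz xy.
have := @sorted_leq_nth _ _ tr (@lexx _ R) 0 _ st i j.
by rewrite !inE sz !ltn_ord !E => /(_ isT isT ij).
Qed.

(** Entries of equal rank in decreasing order are matched. If the entry of [lam] of rank [j]
    exceeded that of [mu], the latter, taken as threshold, would be exceeded by at least [j.+1]
    entries of [lam] and at most [j] entries of [mu]. *)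
Lemma perm_le_of_count lam mu :
  (forall c, (#|[set i | (c < lam i)%R]%SET| <= #|[set i | (c < mu i)%R]%SET|)%N) ->
  exists s : 'S_n, forall i, lam i <= mu (s i).
Proof.
move=> cle; have [s1 h1] := perm_sort_fun lam; have [s2 h2] := perm_sort_fun mu.
exists (s1^-1 * s2)%g => i; rewrite permM; set j := (s1^-1)%g i.
have -> : i = s1 j by rewrite /j permKV.
rewrite leNgt; apply/negP => lt.
have := cle (mu (s2 j)); apply/negP; rewrite -ltnNge.
have card_lt (s : 'S_n) (m : nat) : (m <= n)%N ->
    #|(s @: [set k : 'I_n | (k < m)%N])%SET| = m.
  move=> mn; rewrite card_imset; last exact: perm_inj.
  by rewrite -sum1dep_card (big_ord_narrow mn) sum1_card card_ord.
apply: (@leq_trans j.+1).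
  rewrite ltnS -[X in (_ <= X)%N](card_lt s2 j) ?(ltnW (ltn_ord j))//.
  apply/subset_leq_card/fintype.subsetP => k.
  rewrite inE => ltk; apply/imsetP; exists ((s2^-1)%g k); rewrite ?permKV//.
  by rewrite inE ltnNge; apply/negP => /h2; rewrite permKV leNgt ltk.
rewrite -[X in (X <= _)%N](card_lt s1 j.+1)//.
apply/subset_leq_card/fintype.subsetP => k.
by move=> /imsetP[k']; rewrite !inE ltnS => /h1 le ->; exact: lt_le_trans le.
Qed.

End Sorting.

Section Weyl.
Context {R : realType}.
Local Notation C := R[i].
Local Notation toC := (real_complex R).
Local Open Scope sesquilinear_scope.

Lemma char_poly_similar (F : fieldType) n (D P : 'M[F]_n) : P \in unitmx ->
  char_poly (invmx P *m D *m P) = char_poly D.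
Proof.
move=> Pu; rewrite /char_poly.
have -> : char_poly_mx (invmx P *m D *m P) =
    map_mx polyC (invmx P) *m char_poly_mx D *m map_mx polyC P.
  rewrite /char_poly_mx !map_mxM mulmxBr mulmxBl; congr (_ - _).
  by rewrite -mulmxA mul_scalar_mx -scalemxAr -map_mxM mulVmx// map_mx1 scalemx1.
rewrite !det_mulmx mulrC mulrA -det_mulmx -map_mxM mulmxV//.
by rewrite map_mx1 det1 mul1r.
Qed.

(** The spectral theorem over [R[i]] gives the eigenvalues in some order. Both lists factor the
    characteristic polynomial, hence agree up to a permutation, which is then applied to the rows of
    the unitary matrix. *)
Lemma eigen_list_spectral n (A : 'M[R]_n) lam : A^T = A -> eigen_list A lam ->
  exists2 P : 'M[C]_n, P \is unitarymx &
    map_mx toC A = P^t* *m diag_mx (\row_i (lam i)%:C%C) *m P.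
Proof.
move=> As Al; set Ac := map_mx toC A.
have Acr : Ac \is a realmx.
  by apply/mxOverP => i j; rewrite mxE; apply/complex_realP; exists (A i j).
have Acs : Ac \is symmetricmx.
  apply/is_hermitianmxP; rewrite expr0 scale1r; apply/matrixP => i j.
  by rewrite !mxE/= -{1}As mxE.
have /orthomx_spectralP := symmetric_normalmx Acs Acr.
set P := spectralmx Ac; set d := spectral_diag Ac => AE.
have Pu : P \is unitarymx := spectral_unitarymx Ac.
have : \prod_(x <- [tuple (lam i)%:C%C | i < n]) ('X - x%:P) =
       \prod_(x <- [tuple d 0 i | i < n]) ('X - x%:P) :> {poly C}.
  rewrite !big_tuple.
  transitivity (char_poly Ac).
    rewrite -map_char_poly Al rmorph_prod; apply: eq_bigr => i _.
    by rewrite rmorphB/= map_polyX map_polyC tnth_mktuple.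
  rewrite AE char_poly_similar ?spectral_unit// char_poly_trig ?diag_mx_is_trig//.
  by apply: eq_bigr => i _; rewrite mxE eqxx tnth_mktuple.
move=> /prod_XsubC_eq/tuple_permP[s sE].
have dE i : (lam i)%:C%C = d 0 (s i).
  have := congr1 (fun t => nth 0 t i) sE.
  by rewrite !nth_mktuple tnth_mktuple.
have PsE : (row_perm s P)^t* = P^t* *m perm_mx s^-1.
  by rewrite row_permE trmx_mul map_mxM tr_perm_mx map_perm_mx.
exists (row_perm s P).
  apply/unitarymxP; rewrite PsE row_permE mulmxA -[_ *m P *m _]mulmxA.
  by rewrite (unitarymxP Pu) mulmx1 -perm_mxM mulgV perm_mx1.
rewrite AE invmx_unitary// PsE row_permE !mulmxA; congr (_ *m _).
rewrite -!mulmxA; congr (_ *m _); rewrite mulmxA -row_permE.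
rewrite -[s in RHS]invgK -col_permE.
by apply/matrixP => i j; rewrite !mxE dE !invgK permKV (inj_eq perm_inj).
Qed.

(** For z = x + i y the cross terms cancel by symmetry, and the form is the sum of its values at x
    and at y. *)
Lemma symmetric_form_complex_ge0 n (M : 'M[R]_n) : M^T = M ->
  (forall z : 'rV[R]_n, 0 <= (z *m M *m z^T) 0 0) ->
  forall z : 'rV[C]_n, 0 <= (z *m map_mx toC M *m z^t*) 0 0.
Proof.
move=> Ms M0 z.
pose x := map_mx (@complex.Re R) z; pose y := map_mx (@complex.Im R) z.
have -> : (z *m map_mx toC M *m z^t*) 0 0 =
    ((x *m M *m x^T) 0 0 + (y *m M *m y^T) 0 0)%:C%C; last first.
  by rewrite ler0c addr_ge0.
have cross : x *m M *m y^T = y *m M *m x^T.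
  rewrite -[LHS]trmxK; apply/matrixP => i j; rewrite !ord1 mxE.
  by rewrite !trmx_mul trmxK Ms mulmxA.
have zE : z = map_mx toC x + 'i%C *: map_mx toC y.
  by apply/matrixP => i j; rewrite !mxE -complexE.
have zcE : z^t* = map_mx toC x^T - 'i%C *: map_mx toC y^T.
  apply/matrixP => i j; rewrite !mxE.
  case: (z j i) => a b; apply/eqP; rewrite eq_complex/=.
  by apply/andP; split; apply/eqP; ring.
rewrite zcE {1}zE mulmxDl !mulmxBr !mulmxDl -!scalemxAl -!scalemxAr -!map_mxM cross.
rewrite !mxE; set a := (\sum_j _); set b := \sum_j _; set c := \sum_j _.
rewrite rmorphD/=; have := @sqr_i R; rewrite expr2.
move: ('i%C) => w w2.
by rewrite mulrA w2; ring.
Qed.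

Lemma unitary_form n (P : 'M[C]_n) (d : 'rV[C]_n) (z : 'rV[C]_n) :
  (z *m (P^t* *m diag_mx d *m P) *m z^t*) 0 0 =
  \sum_i d 0 i * `|(z *m P^t*) 0 i| ^+ 2.
Proof.
set w := z *m P^t*.
have wE : P *m z^t* = w^t* by rewrite /w trmx_mul map_mxM trmxCK.
rewrite !mulmxA -/w -mulmxA wE mul_mx_diag mxE; apply: eq_bigr => i _.
by rewrite !mxE normCK; ring.
Qed.

Lemma unitary_coord_eq0 m n (P : 'M[C]_n) (f : 'I_m -> 'I_n) (z : 'rV[C]_n) i :
  P \is unitarymx -> (z <= rowsub f P)%MS -> i \notin codom f ->
  (z *m P^t*) 0 i = 0.
Proof.
move=> /unitarymxP Pu /submxP[c ->] ni.
rewrite -mulmxA mul_rowsub_mx Pu mxE big1// => k _; rewrite !mxE.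
case: eqP => [E|_]; last by rewrite mulr0.
by rewrite -E codom_f in ni.
Qed.

Lemma rowsub_unitary m n (P : 'M[C]_n) (f : 'I_m -> 'I_n) : injective f ->
  P \is unitarymx -> rowsub f P \is unitarymx.
Proof.
move=> fI /unitarymxP Pu; apply/unitarymxP; apply/matrixP => i j.
have := congr1 (fun M : 'M[C]_n => M (f i) (f j)) Pu; rewrite !mxE (inj_eq fI) => <-.
by apply: eq_bigr => k _; rewrite !mxE.
Qed.

(* If the count failed, the spans of the eigenvectors of [A] with eigenvalue
   [> c] and of [B] with eigenvalue [<= c] would meet in a nonzero vector. *)
Lemma weyl_count n (A B : 'M[R]_n) lam mu : A^T = A -> B^T = B ->
  eigen_list A lam -> eigen_list B mu ->
  (forall z : 'rV[R]_n, (z *m A *m z^T) 0 0 <= (z *m B *m z^T) 0 0) ->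
  forall c, (#|[set i | (c < lam i)%R]%SET| <= #|[set i | (c < mu i)%R]%SET|)%N.
Proof.
move=> As Bs Al Bm AB c.
have [P Pu PA] := eigen_list_spectral As Al.
have [Q Qu QB] := eigen_list_spectral Bs Bm.
set I := [set i | (c < lam i)%R]%SET; set J := [set i | (c < mu i)%R]%SET.
rewrite leqNgt; apply/negP => JI.
pose f (i : 'I_#|I|) := enum_val i; pose g (i : 'I_#|~: J|%SET) := enum_val i.
have fI : injective f by exact: enum_val_inj.
have gI : injective g by exact: enum_val_inj.
have rP := mxrank_unitary (rowsub_unitary fI Pu).
have rQ := mxrank_unitary (rowsub_unitary gI Qu).
(* The two ranks add up to [#|I| + (n - #|J|)], which exceeds [n]. *)
have [z zPQ z0] : exists2 z : 'rV[C]_n,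
    (z <= rowsub f P :&: rowsub g Q)%MS & z != 0.
  apply/rowV0Pn; rewrite -mxrank_eq0 -lt0n.
  have := mxrank_sum_cap (rowsub f P) (rowsub g Q); rewrite rP rQ.
  have := rank_leq_col (rowsub f P + rowsub g Q)%MS.
  by have := cardsC J; rewrite card_ord; move: JI; clear; lia.
move: zPQ; rewrite sub_capmx => /andP[zP zQ].
have Mge : 0 <= (z *m map_mx toC (B - A) *m z^t*) 0 0.
  apply: symmetric_form_complex_ge0 => [|w]; first by rewrite linearB/= As Bs.
  by rewrite mulmxBr mulmxBl !mxE subr_ge0; have := AB w; rewrite !mxE.
(* Squared norm of [z] computed in the orthonormal basis of the rows of [T]; by [nzE] it is the same
   for [P] and [Q]. *)
pose nz (T : 'M[C]_n) := \sum_i `|(z *m T^t*) 0 i| ^+ 2.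
have nzE T : T \is unitarymx -> nz T = (z *m z^t*) 0 0.
  move=> Tu; have := unitary_form T (const_mx 1) z.
  rewrite diag_const_mx mulmx1 -invmx_unitary// mulVmx ?unitarymx_unit// mulmx1 => ->.
  by rewrite invmx_unitary//; apply: eq_bigr => i _; rewrite [const_mx _ _ _]mxE mul1r.
have zz : 0 < (z *m z^t*) 0 0 by have := dotmx_is_dotmx z0; rewrite dotmxE.
have leB : (z *m map_mx toC B *m z^t*) 0 0 <= c%:C%C * (z *m z^t*) 0 0.
  rewrite -(nzE Q Qu) QB unitary_form mulr_sumr; apply: ler_sum => j _; rewrite mxE.
  have [jJ|jJ] := boolP (j \in codom g); last first.
    by rewrite (unitary_coord_eq0 Qu zQ jJ) normr0 expr0n/= !mulr0.
  apply: ler_wpM2r; first by rewrite exprn_ge0.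
  move: jJ => /codomP[k ->]; have := enum_valP k; rewrite !inE -leNgt.
  by rewrite lecR.
have ltA : c%:C%C * (z *m z^t*) 0 0 < (z *m map_mx toC A *m z^t*) 0 0.
  rewrite -(nzE P Pu) PA unitary_form mulr_sumr.
  have le i : c%:C%C * `|(z *m P^t*) 0 i| ^+ 2 <=
      (\row_i (lam i)%:C%C) 0 i * `|(z *m P^t*) 0 i| ^+ 2.
    have [iI|iI] := boolP (i \in codom f); last first.
      by rewrite (unitary_coord_eq0 Pu zP iI) normr0 expr0n/= !mulr0.
    apply: ler_wpM2r; first by rewrite exprn_ge0.
    move: iI => /codomP[k ->]; have := enum_valP k; rewrite !inE mxE lecR; exact: ltW.
  (* Equality would annihilate the coordinates of [z] along the eigenvectors with eigenvalue above
     [c]; the others vanish already, so [z] would be zero. *)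
  rewrite lt_neqAle ler_sum// andbT; apply/negP => /eqP E.
  suff : (z *m z^t*) 0 0 = 0 by move=> E0; rewrite E0 ltxx in zz.
  rewrite -(nzE P Pu); apply: big1 => i _.
  have [iI|iI] := boolP (i \in codom f); last first.
    by rewrite (unitary_coord_eq0 Pu zP iI) normr0 expr0n.
  have /eqP : \sum_i ((\row_i (lam i)%:C%C) 0 i * `|(z *m P^t*) 0 i| ^+ 2
      - c%:C%C * `|(z *m P^t*) 0 i| ^+ 2) = 0 by rewrite sumrB E subrr.
  rewrite psumr_eq0; last by move=> k _; rewrite subr_ge0.
  move=> /allP/(_ i (mem_index_enum i))/=; rewrite -mulrBl mulf_eq0 => /orP[|/eqP//].
  rewrite mxE -rmorphB/= -(rmorph0 toC) (inj_eq (@complexI R)) subr_eq0 => lc.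
  move: iI lc => /codomP[k ->]; rewrite /f.
  by have := enum_valP k; rewrite !inE => /gt_eqF->.
have : (z *m map_mx toC A *m z^t*) 0 0 <= (z *m map_mx toC B *m z^t*) 0 0.
  move: Mge; rewrite map_mxB mulmxBr mulmxBl [X in 0 <= X]mxE [X in _ + X]mxE subr_ge0.
  exact.
by move=> /(lt_le_trans ltA)/lt_le_trans-/(_ _ leB); rewrite ltxx.
Qed.

Lemma weyl_monotone n (A B : 'M[R]_n) lam mu : A^T = A -> B^T = B ->
  eigen_list A lam -> eigen_list B mu ->
  (forall z : 'rV[R]_n, (z *m A *m z^T) 0 0 <= (z *m B *m z^T) 0 0) ->
  exists s : 'S_n, forall i, lam i <= mu (s i).
Proof.
by move=> As Bs Al Bm AB; apply: perm_le_of_count; exact: weyl_count AB.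
Qed.

End Weyl.

(** * Symmetric functions of sums of eigenvalues *)

Section SigmaLambda.
Context {R : realType}.

(** With q = (X - c) / a, the matrix X I - (a A + c I) is a (q I - A), so its determinant is a^n
    times the characteristic polynomial of [A] composed with q. *)
Lemma eigen_list_affine n (A : 'M[R]_n) lam (a c : R) : a != 0 ->
  eigen_list A lam -> eigen_list (a *: A + c%:M) (fun i => a * lam i + c).
Proof.
move=> a0 Al; pose q : {poly R} := a^-1 *: ('X - c%:P).
have aq : a%:P * q = 'X - c%:P by rewrite mul_polyC scalerA mulfV// scale1r.
have E : char_poly_mx (a *: A + c%:M) =
    a%:P *: map_mx (comp_poly q) (char_poly_mx A).
  apply/matrixP => i j; rewrite !mxE rmorphB/= rmorphMn/= comp_polyX comp_polyC.
  rewrite mulrBr mulrnAr aq polyCD polyCM polyCMn mulrnBl.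
  by rewrite opprD addrA [RHS]addrAC addrAC.
rewrite /eigen_list /char_poly E detZ det_map_mx.
have -> : \det (char_poly_mx A) = \prod_(i < n) ('X - (lam i)%:P) by exact: Al.
rewrite rmorph_prod -[n in _ ^+ n]card_ord -prodr_const -big_split/=.
apply: eq_bigr => i _; rewrite rmorphB/= comp_polyX comp_polyC mulrBr aq.
by rewrite polyCD polyCM opprD addrA addrAC.
Qed.

Lemma sigma_bij (T T' : finType) (h : T -> T') m (x : T' -> R) : bijective h ->
  sigma m (x \o h) = sigma m x.
Proof.
move=> [g hg gh]; have hI := can_inj hg; rewrite /sigma.
rewrite [RHS](reindex_onto (fun A : {set T} => h @: A)%SET
  (fun A : {set T'} => g @: A)%SET)/=; last first.
  by move=> A _; rewrite -imset_comp (eq_imset _ gh) imset_id.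
apply: eq_big => [A|A _]; last by rewrite big_imset//; move=> ? ? _ _; exact: hI.
by rewrite card_imset// -imset_comp (eq_imset _ hg) imset_id eqxx andbT.
Qed.

(** A permutation acts on the [P]-subsets by direct image and only reindexes [Lambda]. This absorbs
    the permutation produced by [weyl_monotone]. *)
Lemma sigmaLambda_perm n P m (s : 'S_n) (mu : 'I_n -> R) :
  sigmaLambda P m (mu \o s) = sigmaLambda P m mu.
Proof.
have cI (t : 'S_n) (I : Psubsets n P) : #|(t @: val I)%SET| == P.
  by rewrite card_imset; [exact: (valP I) | exact: perm_inj].
pose h (t : 'S_n) (I : Psubsets n P) : Psubsets n P := Sub (t @: val I)%SET (cI t I).
have hK t : cancel (h t) (h t^-1)%g.
  move=> I; apply: val_inj; rewrite /= -imset_comp -[RHS]imset_id.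
  by apply: eq_imset => i /=; rewrite permK.
rewrite /sigmaLambda -[RHS](@sigma_bij _ _ (h s)); last first.
  by exists (h s^-1)%g => //; rewrite -{2}[s]invgK.
congr sigma; apply/funext => I; rewrite /Lambda /=.
by rewrite big_imset//= => ? ? _ _; exact: perm_inj.
Qed.

Lemma sigmaLambda_quotient_mono n P k l (lam mu : 'I_n -> R) (s : 'S_n) :
  (l <= k)%N -> inGammaLambda P k lam -> (forall i, lam i <= mu (s i)) ->
  sigmaLambda P k lam / sigmaLambda P l lam <=
  sigmaLambda P k mu / sigmaLambda P l mu.
Proof.
move=> lk Gl le; rewrite -!(sigmaLambda_perm P _ s mu).
by apply: sigma_quotient_mono => // I; apply: ler_sum => i _; exact: le.
Qed.

Lemma sigmaLambdaZ n P m (c : R) (lam : 'I_n -> R) :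
  sigmaLambda P m (fun i => c * lam i) = c ^+ m * sigmaLambda P m lam.
Proof.
rewrite /sigmaLambda -sigmaZ; congr sigma; apply/funext => I.
by rewrite /Lambda mulr_sumr.
Qed.

Lemma sigmaLambda_gt0 n P k j (lam : 'I_n -> R) :
  inGammaLambda P k lam -> (j <= k)%N -> 0 < sigmaLambda P j lam.
Proof. exact: Gamma_sigma_gt0. Qed.

Lemma inGammaLambdaZ n P k (c : R) (lam : 'I_n -> R) : 0 < c ->
  inGammaLambda P k lam -> inGammaLambda P k (fun i => c * lam i).
Proof. by move=> c0 G j jk; rewrite sigmaLambdaZ mulr_gt0 ?exprn_gt0 ?G. Qed.

(** Adding [s] to every eigenvalue adds [P%:R * s] to each entry of [Lambda], so the function is a
    polynomial in [s]. Shifts by scalar matrices are the only matrix variations along which the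
    quotient gets differentiated. *)
Lemma derivable_sigmaLambda_shift n P m (lam : 'I_n -> R) (x : R) :
  derivable (fun s : R => sigmaLambda P m (fun i => lam i + s)) x 1.
Proof.
pose p : {poly R} := \sum_(A : {set Psubsets n P} | #|A| == m)
  \prod_(I in A) ((Lambda lam I)%:P + P%:R *: 'X).
have -> : (fun s : R => sigmaLambda P m (fun i => lam i + s)) = horner p.
  apply/funext => s; rewrite horner_sum; apply: eq_bigr => A _.
  rewrite horner_prod; apply: eq_bigr => I _.
  rewrite !hornerE /Lambda big_split/= sumr_const; congr (_ + _).
  by have /eqP-> := valP I; rewrite mulr_natl.
exact: derivable_horner.
Qed.

End SigmaLambda.

(** * Functions of class C^k of several variables *)

Section Calculus.
Context {R : realType}.
Local Open Scope classical_set_scope.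

Lemma is_derive_line (V : normedModType R) (g : V -> R) (w v : V) (s : R) :
  derivable g (w + s *: v) v ->
  is_derive s 1 (fun s => g (w + s *: v)) ('D_v g (w + s *: v)).
Proof.
have E : (fun h : R => h^-1 *: (((fun s => g (w + s *: v)) \o shift s) (h *: 1)
            - g (w + s *: v))) =
         (fun h => h^-1 *: ((g \o shift (w + s *: v)) (h *: v) - g (w + s *: v))).
  apply/funext => h /=; congr (_ *: (g _ - _)).
  by rewrite [h *: 1]mulr1 scalerDl addrCA.
by move=> dg; apply: DeriveDef; rewrite /derivable /derive E.
Qed.

Lemma mean_value_bound (f df : R -> R) (a c e : R) :
  (forall s : R, `|s| <= `|a| -> is_derive s 1 f (df s)) ->
  (forall s, `|s| <= `|a| -> `|df s - c| <= e) ->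
  `|f a - f 0 - c * a| <= e * `|a|.
Proof.
move=> fd dfc.
(* The pair [x], [y] stands for [0], [a] or for [a], [0], which covers both signs of [a]. *)
have itv s x y : x <= 0 -> 0 <= y -> (x = 0 /\ y = a) \/ (x = a /\ y = 0) ->
    s \in `[x, y]%R -> `|s| <= `|a|.
  move=> x0 y0 xy; rewrite in_itv/= => /andP[xs sy].
  by rewrite ler_norml; case: xy => -[? ?]; subst;
    [rewrite ger0_norm|rewrite ler0_norm]; lra.
have cont x y : x <= 0 -> 0 <= y -> (x = 0 /\ y = a) \/ (x = a /\ y = 0) ->
    {within `[x, y], continuous f}.
  move=> x0 y0 xy; apply: derivable_within_continuous => s sxy.
  by have [] := fd s (itv s x y x0 y0 xy sxy).
have bound x y : x <= 0 -> 0 <= y -> (x = 0 /\ y = a) \/ (x = a /\ y = 0) ->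
    `|f y - f x - c * (y - x)| <= e * `|a|.
  move=> x0 y0 xy; have xley : x <= y by lra.
  have [|s sxy ->] := MVT_segment xley _ (cont x y x0 y0 xy) (df := df).
    by move=> s sxy; apply: fd; apply: itv xy _ => //; exact: subset_itv_oo_cc.
  have := dfc s (itv s x y x0 y0 xy sxy) => le.
  rewrite -mulrBl normrM.
  have -> : `|y - x| = `|a|.
    by case: xy => -[-> ->]; rewrite ?subr0 ?sub0r ?normrN.
  by rewrite ler_wpM2r.
have [a0|a0] := leP 0 a.
  by have := bound 0 a (lexx _) a0 (or_introl (conj erefl erefl)); rewrite subr0.
have := bound a 0 (ltW a0) (lexx _) (or_intror (conj erefl erefl)).
by rewrite sub0r -normrN; congr (`|_| <= _); ring.
Qed.

Lemma le_mx_norm_coord m (h : 'rV[R]_m) i : `|h 0 i| <= `|h|.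
Proof.
rewrite [leRHS]/Num.Def.normr/= mx_normrE.
exact: (le_bigmax _ (fun k : 'I_1 * 'I_m => `|h k.1 k.2|) (0, i)).
Qed.

Lemma mx_norm_le m (h : 'rV[R]_m) e : 0 <= e -> (forall i, `|h 0 i| <= e) -> `|h| <= e.
Proof.
move=> e0 he; rewrite [leLHS]/Num.Def.normr/= mx_normrE bigmax_le// => -[i j] _ /=.
by rewrite ord1.
Qed.

Definition pdiff m (g : 'rV[R]_m -> R) (y h : 'rV[R]_m) : R :=
  \sum_i h 0 i * pd g i y.

(** The coordinates of the increment are switched on one at a time, with [mean_value_bound] on each
    segment. *)
Lemma C1_approx m (D : set 'rV[R]_m) (g : 'rV[R]_m -> R) y : open D -> D y ->
  Ck 1 D g -> forall e, 0 < e ->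
  exists2 d, 0 < d & forall h, `|h| < d -> D (y + h) /\
    `|g (y + h) - g y - pdiff g y h| <= e * `|h|.
Proof.
move=> oD Dy [_ gC] e e0.
(* Each of the [m] coordinate steps costs at most [e'] times the norm of [h]; the divisor [m.+1] is
   nonzero even for [m = 0]. *)
pose e' := e / m.+1%:R; have e'0 : 0 < e' by rewrite divr_gt0.
have : \forall w \near y, D w /\ forall i, `|pd g i y - pd g i w| <= e'.
  near=> w; split; first by near: w; exact: open_nbhs_nbhs.
  near: w; apply: filter_forall => i; have [_ ci] := gC i.
  by have /cvgrPdist_le := ci y Dy; apply.
move=> /nbhs_normP[d /= d0 Hd]; exists d => // h hd.
(* [t k] keeps the first [k] coordinates of [h]: the broken path runs from [y] to [y + h] and, in
   the sup norm, stays in the ball. *)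
pose t k : 'rV[R]_m := \row_j (if (j < k)%N then h 0 j else 0).
have inb (k : 'I_m) s : `|s| <= `|h 0 k| ->
    D (y + t k + s *: ev R k) /\
    forall i, `|pd g i y - pd g i (y + t k + s *: ev R k)| <= e'.
  move=> sh; apply: Hd; rewrite /ball_/= -addrA opprD addNKr normrN.
  apply: le_lt_trans hd; apply: mx_norm_le => // j; rewrite !mxE.
  case: ltnP => jk; last first.
    rewrite add0r; case: eqP => _; rewrite ?mulr1 ?mulr0 ?normr0//.
    exact: le_trans sh (le_mx_norm_coord _ _).
  have -> : (k == j) = false by apply/eqP => kj; rewrite kj ltnn in jk.
  by rewrite mulr0 addr0 le_mx_norm_coord.
have step (k : 'I_m) :
    `|g (y + t k.+1) - g (y + t k) - h 0 k * pd g k y| <= e' * `|h|.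
  have tS : t k.+1 = t k + h 0 k *: ev R k.
    apply/rowP => j; rewrite !mxE ltnS -val_eqE/=.
    by case: (ltngtP j k) => [_|_|/val_inj->]; rewrite ?mulr0 ?addr0 ?add0r ?mulr1.
  have := @mean_value_bound (fun s => g (y + t k + s *: ev R k))
    (fun s => pd g k (y + t k + s *: ev R k)) (h 0 k) (pd g k y) e'.
  rewrite scale0r addr0 tS addrA [pd g k y * _]mulrC => H.
  apply: le_trans (H _ _) _.
  - by move=> s /inb[Ds _]; apply: is_derive_line; have [dk _] := gC k; exact: dk.
  - by move=> s /inb[_ /(_ k)]; rewrite distrC.
  - by apply: ler_wpM2l; [exact: ltW | exact: le_mx_norm_coord].
split; first by have [] := Hd (y + h) _; rewrite ?/ball_/= ?opprD ?addNKr ?normrN.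
have -> : g (y + h) - g y - pdiff g y h =
    \sum_(k < m) (g (y + t k.+1) - g (y + t k) - h 0 k * pd g k y).
  rewrite sumrB; congr (_ - _).
  rewrite -(big_mkord xpredT (fun k => g (y + t k.+1) - g (y + t k))).
  rewrite telescope_sumr//; congr (g _ - g _).
    by congr (_ + _); apply/rowP => j; rewrite mxE ltn_ord.
  by rewrite -[LHS]addr0; congr (_ + _); apply/rowP => j; rewrite !mxE ltn0.
apply: le_trans (ler_norm_sum _ _ _) _.
apply: (@le_trans _ _ (\sum_(k < m) e' * `|h|)); first exact: ler_sum.
rewrite sumr_const card_ord -mulr_natl mulrA ler_wpM2r// /e'.
by rewrite mulrCA ger_pMr// ler_pdivrMr// mul1r ler_nat.
Unshelve. all: by end_near. Qed.

Lemma pdiff_is_linear m (g : 'rV[R]_m -> R) y : linear (pdiff g y).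
Proof.
move=> a h k; rewrite /pdiff scaler_sumr -big_split/=; apply: eq_bigr => i _.
by rewrite !mxE mulrDl /GRing.scale/= mulrA.
Qed.

HB.instance Definition _ m (g : 'rV[R]_m -> R) y :=
  GRing.isLinear.Build R 'rV[R]_m R *:%R (pdiff g y) (@pdiff_is_linear m g y).

Lemma pdiff_continuous m (g : 'rV[R]_m -> R) y : continuous (pdiff g y).
Proof.
have -> : pdiff g y = \sum_i (fun h : 'rV[R]_m => h 0 i * pd g i y).
  by apply/funext => h; rewrite fct_sumE.
move=> h; apply: differentiable_continuous; apply: differentiable_sum => i.
by apply: differentiableM => //; exact: differentiable_coord.
Qed.

Lemma C1_differentiable m (D : set 'rV[R]_m) (g : 'rV[R]_m -> R) y :
  open D -> D y -> Ck 1 D g ->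
  differentiable g y /\ forall h, 'd g y h = pdiff g y h.
Proof.
move=> oD Dy gC.
have gE e : 0 < e -> \forall h \near (0 : 'rV[R]_m),
    `|g (h + y) - (g y + pdiff g y h)| <= e * `|h|.
  move=> e0; have [d d0 Hd] := C1_approx oD Dy gC e0.
  apply/nbhs_normP; exists d => //= h; rewrite /ball_/= sub0r normrN => hd.
  by have [_] := Hd h hd; rewrite [h + y]addrC opprD addrA.
have dE : 'd g y = pdiff g y :> ('rV[R]_m -> R).
  by apply: diff_unique; [exact: pdiff_continuous | exact/eqaddoP].
split; last by move=> h; rewrite dE.
apply/diff_locallyP; rewrite dE; split; first exact: pdiff_continuous.
exact/eqaddoP.
Qed.

Lemma is_derive_curve m (D : set 'rV[R]_m) (g : 'rV[R]_m -> R)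
    (c : R -> 'rV[R]_m) (dc : 'rV[R]_m) t :
  open D -> D (c t) -> Ck 1 D g ->
  (forall i, is_derive t 1 (fun s => c s 0 i) (dc 0 i)) ->
  is_derive t 1 (g \o c) (pdiff g (c t) dc).
Proof.
move=> oD Dc gC cd; have [dg dgE] := C1_differentiable oD Dc gC.
have dct : derivable c t 1.
  by apply/derivable_mxP => i j; rewrite ord1; have [] := cd j.
have cdiff : differentiable c t by exact/derivable1_diffP.
apply: DeriveDef; first by apply/derivable1_diffP; exact: differentiable_comp.
rewrite deriveE; last exact: differentiable_comp.
rewrite diff_comp//= dgE -deriveE// derive_mx//; congr pdiff.
by apply/rowP => j; rewrite mxE; have [_ ->] := cd j.
Qed.

(** The second difference is the increment from r = 0 to r = s of g(y + s e_j + r e_i) - g(y + r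
    e_i), whose derivative in r differs from s times the mixed derivative by at most e s. *)
Lemma mixed_difference m (D : set 'rV[R]_m) (g : 'rV[R]_m -> R) y i j :
  open D -> D y -> Ck 2 D g -> forall e, 0 < e -> \forall s \near 0^'+,
  `|g (y + s *: ev R i + s *: ev R j) - g (y + s *: ev R i) -
    g (y + s *: ev R j) + g y - s ^+ 2 * pd (pd g i) j y| <= e * s ^+ 2.
Proof.
move=> oD Dy gC e e0; have [_ /(_ i)[di giC]] := gC.
(* The expansions of [pd g i] at increments of norm at most [2 * s] and [s] contribute [3 * e' * s]
   in total. *)
pose e' := e / 3; have e'0 : 0 < e' by rewrite divr_gt0.
have [d d0 Hd] := C1_approx oD Dy giC e'0.
near=> s.
have s0 : 0 < s by near: s; exact: nbhs_right_gt.
have s2d : 2 * s < d.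
  by rewrite -ltr_pdivlMl//; near: s; apply: nbhs_right_lt; rewrite mulr_gt0.
have nev k : `|ev R k : 'rV[R]_m| <= 1.
  by apply: mx_norm_le => // l; rewrite mxE; case: eqP; rewrite ?normr1 ?normr0.
have small r : `|r| <= `|s| ->
    `|r *: ev R i + s *: ev R j : 'rV[R]_m| <= 2 * s /\ `|r *: ev R i : 'rV[R]_m| <= s.
  move=> rs; have ri : `|r *: ev R i : 'rV[R]_m| <= s.
    by rewrite normrZ -[leRHS]mulr1 ler_pM// -(gtr0_norm s0).
  split=> //; apply: le_trans (ler_normD _ _) _; rewrite mulr_natl mulr2n lerD//.
  by rewrite normrZ gtr0_norm// -[leRHS]mulr1 ler_pM2l.
have := @mean_value_bound
  (fun r => g (y + s *: ev R j + r *: ev R i) - g (y + r *: ev R i))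
  (fun r => pd g i (y + s *: ev R j + r *: ev R i) - pd g i (y + r *: ev R i))
  s (s * pd (pd g i) j y) (e * s).
rewrite !scale0r !addr0 gtr0_norm// => H.
have -> : g (y + s *: ev R i + s *: ev R j) - g (y + s *: ev R i) -
    g (y + s *: ev R j) + g y - s ^+ 2 * pd (pd g i) j y =
   g (y + s *: ev R j + s *: ev R i) - g (y + s *: ev R i) -
    (g (y + s *: ev R j) - g y) - s * pd (pd g i) j y * s.
  by rewrite (addrAC y); ring.
have s2s : s <= 2 * s by lra.
rewrite expr2 mulrA; apply: H => r rs; rewrite -(gtr0_norm s0) in rs;
    have [rs1 rs2] := small r rs;
    have [D1 B1] := Hd _ (le_lt_trans rs1 s2d);
    have [D2 B2] := Hd _ (le_lt_trans (le_trans rs2 s2s) s2d);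
    rewrite [_ + s *: _]addrC addrA in D1 B1.
  by apply: is_deriveB; apply: is_derive_line; exact: di.
have pe : pdiff (pd g i) y (s *: ev R j + r *: ev R i) =
    s * pd (pd g i) j y + pdiff (pd g i) y (r *: ev R i).
  rewrite linearD/= linearZ/=; congr (_ * _ + _).
  rewrite /pdiff (bigD1 j)//= mxE eqxx mul1r big1 ?addr0// => k kj.
  by rewrite mxE eq_sym (negbTE kj) mul0r.
rewrite pe in B1; move: B1 B2.
rewrite [_ *: ev R j + _]addrC; move=> B1 B2.
have {}B1 := le_trans B1 (ler_wpM2l (ltW e'0) rs1).
have {}B2 := le_trans B2 (ler_wpM2l (ltW e'0) rs2).
have -> : e * s = e' * (2 * s) + e' * s by rewrite /e'; field.
apply: le_trans (lerD B1 B2); apply: le_trans (ler_normB _ _).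
by rewrite le_eqVlt; apply/orP; left; apply/eqP; congr (`|_|); ring.
Unshelve. all: by end_near. Qed.

(** Schwarz's theorem: the second difference is symmetric in [i] and [j], so both mixed derivatives
    lie within [e / 2] of its quotient by [s ^+ 2]. *)
Lemma pd_comm m (D : set 'rV[R]_m) (g : 'rV[R]_m -> R) i j y :
  open D -> D y -> Ck 2 D g -> pd (pd g i) j y = pd (pd g j) i y.
Proof.
move=> oD Dy gC; apply/eqP; rewrite -subr_eq0 -normr_le0; apply/ler_addgt0Pr => e e0.
rewrite add0r; have e20 : 0 < e / 2 by rewrite divr_gt0.
have N1 := @mixed_difference _ _ _ _ i j oD Dy gC _ e20.
have N2 := @mixed_difference _ _ _ _ j i oD Dy gC _ e20.
have N0 : \forall s \near (0 : R)^'+, 0 < s by exact: nbhs_right_gt.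
have [s [s0 [B1]]] := filter_ex (filterI N0 (filterI N1 N2)).
rewrite (addrAC y (s *: ev R j)) => B2; move: B1 B2.
move: (g (y + s *: ev R i + s *: ev R j)) (g (y + s *: ev R i)).
move: (g (y + s *: ev R j)) (g y).
move: (pd (pd g i) j y) (pd (pd g j) i y) => p q c d a b B1 B2.
have s20 : 0 < s ^+ 2 by rewrite exprn_gt0.
rewrite -(ler_pM2r s20).
have -> : e * s ^+ 2 = e / 2 * s ^+ 2 + e / 2 * s ^+ 2 by field.
apply: le_trans (lerD B2 B1); apply: le_trans (ler_normB _ _).
rewrite -{1}(gtr0_norm s20) -normrM.
by rewrite le_eqVlt; apply/orP; left; apply/eqP; congr (`|_|); ring.
Qed.

End Calculus.

(** * Algebraic operations on functions of class C^k *)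

Section CkAlgebra.
Context {R : realType} {m : nat} (D : set 'rV[R]_m) (oD : open D).
Local Open Scope classical_set_scope.
Implicit Types f g : 'rV[R]_m -> R.

Lemma near_open f g y : D y -> (forall z, D z -> f z = g z) -> \near y, f y = g y.
Proof.
by move=> Dy fg; near=> z; apply: fg; near: z; exact: open_nbhs_nbhs.
Unshelve. all: by end_near. Qed.

Lemma pd_ext f g i y : D y -> (forall z, D z -> f z = g z) -> pd f i y = pd g i y.
Proof. by move=> Dy fg; exact/near_eq_derive/near_open. Qed.

(** As [D] is open, derivatives at its points depend only on values on [D]. This lets a partial
    derivative be replaced by a formula known only on [D]. *)
Lemma Ck_ext k f g : (forall y, D y -> f y = g y) -> Ck k D f -> Ck k D g.
Proof.
have ext0 (f' g' : 'rV[R]_m -> R) : (forall y, D y -> f' y = g' y) ->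
    (forall y, D y -> {for y, continuous f'}) -> forall y, D y -> {for y, continuous g'}.
  move=> fg cf y Dy; rewrite /prop_for /continuous_at -(fg y Dy).
  exact: cvg_trans (near_eq_cvg (near_open Dy fg)) (cf y Dy).
elim: k f g => [|k IH] f g fg; first exact: ext0.
move=> [cf df]; split; first exact: ext0 fg cf.
move=> i; have [dfi cfi] := df i; split.
  by move=> y Dy; exact: near_eq_derivable (near_open Dy fg) (dfi y Dy).
by apply: IH cfi => y Dy; exact: pd_ext.
Qed.

Lemma CkW k f : Ck k.+1 D f -> Ck k D f.
Proof.
elim: k f => [|k IH] f [cf df] //; split => // i; have [dfi cfi] := df i.
by split => //; exact: IH.
Qed.

Lemma Ck_le k k' f : (k' <= k)%N -> Ck k D f -> Ck k' D f.
Proof.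
move=> /subnKC <-; elim: (k - k')%N => [|d IH]; first by rewrite addn0.
by rewrite addnS => /CkW.
Qed.

Lemma CkS_pd k f i : Ck k.+1 D f -> Ck k D (pd f i).
Proof. by move=> [_ /(_ i)[]]. Qed.

Lemma CkD k f g : Ck k D f -> Ck k D g -> Ck k D (fun y => f y + g y).
Proof.
elim: k f g => [|k IH] f g; first by move=> cf cg y Dy; exact: cvgD (cf y Dy) (cg y Dy).
move=> [cf df] [cg dg]; split; first by move=> y Dy; exact: cvgD (cf y Dy) (cg y Dy).
move=> i; have [dfi cfi] := df i; have [dgi cgi] := dg i; split.
  by move=> y Dy; exact: derivableD (dfi y Dy) (dgi y Dy).
apply: Ck_ext (IH _ _ cfi cgi) => y Dy.
by rewrite /pd (deriveD (dfi y Dy) (dgi y Dy)).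
Qed.

Lemma pdM f g i y : derivable f y (ev R i) -> derivable g y (ev R i) ->
  pd (fun y => f y * g y) i y = f y * pd g i y + g y * pd f i y.
Proof. by move=> df dg; rewrite /pd (deriveM df dg). Qed.

Lemma CkM k f g : Ck k D f -> Ck k D g -> Ck k D (fun y => f y * g y).
Proof.
elim: k f g => [|k IH] f g; first by move=> cf cg y Dy; exact: cvgM (cf y Dy) (cg y Dy).
move=> Cf Cg; have [cf df] := Cf; have [cg dg] := Cg.
split; first by move=> y Dy; exact: cvgM (cf y Dy) (cg y Dy).
move=> i; have [dfi cfi] := df i; have [dgi cgi] := dg i; split.
  by move=> y Dy; exact: derivableM (dfi y Dy) (dgi y Dy).
apply: Ck_ext (CkD (IH _ _ (CkW Cf) cgi) (IH _ _ (CkW Cg) cfi)) => y Dy.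
by rewrite (pdM (dfi y Dy) (dgi y Dy)).
Qed.

Lemma CkN k f : Ck k D f -> Ck k D (fun y => - f y).
Proof.
elim: k f => [|k IH] f; first by move=> cf y Dy; exact: cvgN (cf y Dy).
move=> [cf df]; split; first by move=> y Dy; exact: cvgN (cf y Dy).
move=> i; have [dfi cfi] := df i; split.
  by move=> y Dy; exact: derivableN (dfi y Dy).
by apply: Ck_ext (IH _ cfi) => y Dy; rewrite /pd (deriveN (dfi y Dy)).
Qed.

Lemma pdV f i y : f y != 0 -> derivable f y (ev R i) ->
  pd (fun y => (f y)^-1) i y = - ((f y)^-1 * (f y)^-1 * pd f i y).
Proof.
move=> f0 df; rewrite /pd (deriveV f0 df) -mulNr -invfM -expr2.
by rewrite -[LHS]/(- _ * _).
Qed.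

Lemma CkV k f : (forall y, D y -> f y != 0) -> Ck k D f ->
  Ck k D (fun y => (f y)^-1).
Proof.
move=> f0; elim: k => [|k IH]; first by move=> cf y Dy; exact: cvgV (f0 y Dy) (cf y Dy).
move=> Cf; have [cf df] := Cf; split.
  by move=> y Dy; exact: cvgV (f0 y Dy) (cf y Dy).
move=> i; have [dfi cfi] := df i; split.
  by move=> y Dy; exact: derivableV (f0 y Dy) (dfi y Dy).
have IHf := IH (CkW Cf).
apply: Ck_ext (CkN (CkM (CkM IHf IHf) cfi)) => y Dy.
by rewrite (pdV (f0 y Dy) (dfi y Dy)).
Qed.

End CkAlgebra.

(** * One-variable derivative tests *)

Section RealTests.
Context {R : realType}.
Local Open Scope classical_set_scope.
Implicit Types f g : R -> R.

Lemma is_derive_approx f (x d : R) : is_derive x 1 f d -> forall e, 0 < e ->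
  \forall h \near 0, `|f (x + h) - f x - d * h| <= e * `|h|.
Proof.
move=> [df <-] e e0.
have : \forall h \near 0^', `|'D_1 f x - h^-1 *: (f (h *: 1 + x) - f x)| <= e.
  by have /cvgrPdist_le := df; apply.
rewrite near_withinE => H; near=> h.
have [->|h0] := eqVneq h 0; first by rewrite addr0 mulr0 subr0 subrr normr0 mulr0.
have : h != 0 -> `|'D_1 f x - h^-1 *: (f (h *: 1 + x) - f x)| <= e.
  by near: h; exact: H.
rewrite [h *: 1]mulr1 [h + x]addrC => /(_ h0) le.
have -> : f (x + h) - f x - 'D_1 f x * h =
    - (('D_1 f x - h^-1 *: (f (x + h) - f x)) * h).
  by rewrite /GRing.scale/=; field.
by rewrite normrN normrM ler_wpM2r.
Unshelve. all: by end_near. Qed.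

(** If [d2] were positive, [df] would be positive just to the right of [0], and the mean value
    theorem would contradict maximality. *)
Lemma second_derivative_at_max f df (d2 : R) :
  (forall s : R, is_derive s 1 f (df s)) -> is_derive (0 : R) 1 df d2 ->
  (forall s, f s <= f 0) -> df 0 = 0 /\ d2 <= 0.
Proof.
move=> fd dfd fmax.
have df0 : df 0 = 0.
  have [_ <-] := fd 0.
  have [||||_ ->//] := @derive1_at_max R f (-1) 1 0.
  - lra.
  - by move=> t _; have [] := fd t.
  - by rewrite in_itv/=; apply/andP; split; lra.
  - by move=> t _; exact: fmax.
split=> //; rewrite leNgt; apply/negP => d20.
(* The tolerance [d2 / 2] leaves df(c) >= (d2 / 2) c > 0 for small c > 0. *)
have /nbhs_normP[r /= r0 H] := is_derive_approx dfd (divr_gt0 d20 (ltr0Sn _ 1)).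
pose a := r / 2; have a0 : 0 < a by rewrite divr_gt0.
have fc : {within `[0, a], continuous f}.
  by apply: derivable_within_continuous => s _; have [] := fd s.
have [c] := MVT a0 (fun s _ => fd s) fc.
rewrite in_itv/= subr0 => /andP[c0 ca] E.
have := fmax a; rewrite -subr_le0 E leNgt mulr_gt0//.
have cr : `|0 - c| < r by rewrite sub0r normrN gtr0_norm//; rewrite /a in ca; lra.
have /= := H c cr; rewrite add0r df0 subr0 (gtr0_norm c0) ler_norml => /andP[lo _].
have : 0 < d2 * c by rewrite mulr_gt0.
lra.
Qed.

(** Comparing slopes at [0] gives f' <= e g' for every e > 0, and [e] is arbitrary. *)
Lemma derivative_le0_of_dominated f g (f' g' : R) :
  is_derive (0 : R) 1 f f' -> is_derive (0 : R) 1 g g' -> f 0 = g 0 ->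
  (forall e, 0 < e -> \forall t \near 0^'+, f t <= g (e * t)) -> f' <= 0.
Proof.
move=> fd gd fg0 fg; rewrite leNgt; apply/negP => f'0.
(* For small [t], the function [f] gains at least 3/4 of [f' * t], while [g (e * t)] gains at most
   1/4 of it; the [+ 1] absorbs the error in the expansion of [g]. *)
pose e := f' / (4 * (`|g'| + 1)).
have g1 : 0 < `|g'| + 1 by rewrite ltr_wpDl.
have e0 : 0 < e by rewrite divr_gt0// mulr_gt0.
have eE : e * (`|g'| + 1) = f' / 4 by rewrite /e; field; rewrite gt_eqF.
have f4 : 0 < f' / 4 by rewrite divr_gt0.
have := is_derive_approx fd f4; have := is_derive_approx gd ltr01.
move=> /nbhs_normP[r /= r0 Hg] /nbhs_normP[r' /= r'0 Hf].
near (0 : R)^'+ => t.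
have t0 : 0 < t by near: t; exact: nbhs_right_gt.
have et0 : 0 < e * t by rewrite mulr_gt0.
have tr' : t < r' by near: t; exact: nbhs_right_lt.
have tr : e * t < r.
  by rewrite -ltr_pdivlMl//; near: t; apply: nbhs_right_lt; rewrite mulr_gt0 ?invr_gt0.
have le : f t <= g (e * t) by near: t; exact: fg.
have := Hg (e * t); rewrite /ball_/= sub0r normrN (gtr0_norm et0) add0r mul1r => /(_ tr).
have := Hf t; rewrite /ball_/= sub0r normrN (gtr0_norm t0) add0r => /(_ tr').
rewrite !ler_norml => /andP[lo _] /andP[_ up].
have : g' * (e * t) <= `|g'| * (e * t) by rewrite ler_wpM2r ?ler_norm// ltW.
have : e * (`|g'| + 1) * t = f' / 4 * t by rewrite eE.
have : 0 < f' * t by rewrite mulr_gt0.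
rewrite fg0 in lo; move: lo up le; lra.
Unshelve. all: by end_near. Qed.

End RealTests.

(** * Great circles and tangent frames *)

Section PointwiseDerivatives.
Context {R : realType} (x : R).
Implicit Types f g : R -> R.

Lemma is_derive_cst_fun (a : R) : is_derive x 1 (fun=> a) (0 : R).
Proof. exact: is_derive_cst. Qed.

Lemma is_derive_add f g (df dg : R) : is_derive x 1 f df -> is_derive x 1 g dg ->
  is_derive x 1 (fun s => f s + g s) (df + dg).
Proof. by move=> fd gd; exact: is_deriveD. Qed.

Lemma is_derive_mul f g (df dg : R) : is_derive x 1 f df -> is_derive x 1 g dg ->
  is_derive x 1 (fun s => f s * g s) (df * g x + f x * dg).
Proof.
by move=> fd gd; apply: is_derive_eq (is_deriveM fd gd) _; rewrite /GRing.scale/=; ring.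
Qed.

Lemma is_derive_bigsum m (f : 'I_m -> R -> R) (df : 'I_m -> R) :
  (forall i, is_derive x 1 (f i) (df i)) ->
  is_derive x 1 (fun s => \sum_i f i s) (\sum_i df i).
Proof.
move=> fd; have -> : (fun s => \sum_i f i s) = \sum_i f i.
  by apply/funext => s; rewrite fct_sumE.
exact: is_derive_sum.
Qed.

End PointwiseDerivatives.

Section EuclideanRows.
Context {R : realType} {m : nat}.
Implicit Types x y z : 'rV[R]_m.

Lemma edotC x y : edot x y = edot y x.
Proof. by apply: eq_bigr => i _; rewrite mulrC. Qed.

Lemma edotDr x y z : edot x (y + z) = edot x y + edot x z.
Proof. by rewrite -big_split; apply: eq_bigr => i _; rewrite mxE mulrDr. Qed.

Lemma edotZr a x y : edot x (a *: y) = a * edot x y.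
Proof. by rewrite /edot mulr_sumr; apply: eq_bigr => i _; rewrite mxE mulrCA. Qed.

Lemma edotDl x y z : edot (x + y) z = edot x z + edot y z.
Proof. by rewrite edotC edotDr !(edotC z). Qed.

Lemma edotZl a x y : edot (a *: x) y = a * edot x y.
Proof. by rewrite edotC edotZr edotC. Qed.

Lemma edot_ge0 x : 0 <= edot x x.
Proof. by apply: sumr_ge0 => i _; rewrite -expr2 sqr_ge0. Qed.

Lemma edot_eq0 x : edot x x = 0 -> x = 0.
Proof.
move=> /eqP; rewrite psumr_eq0; last by move=> i _; rewrite -expr2 sqr_ge0.
move=> /allP xx; apply/rowP => i; rewrite mxE; apply/eqP.
by have := xx i (mem_index_enum i); rewrite /= mulf_eq0 orbb.
Qed.

Lemma edot_mulmx x y : edot x y = (x *m y^T) 0 0.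
Proof. by rewrite mxE; apply: eq_bigr => i _; rewrite mxE. Qed.

Lemma mulmx_tr_edot x y : x *m y^T = (edot x y)%:M.
Proof.
by apply/matrixP => i j; rewrite !ord1 edot_mulmx [RHS]mxE eqxx mulr1n.
Qed.

Lemma edot_unit_le x y : edot x x = 1 -> edot x y ^+ 2 <= edot y y.
Proof.
move=> x1; have := edot_ge0 (y + (- edot x y) *: x).
rewrite !(edotDl, edotDr, edotZl, edotZr) x1 (edotC y x); lra.
Qed.

Lemma enorm_ge0 x : 0 <= enorm x.
Proof. exact: sqrtr_ge0. Qed.

Lemma sqr_enorm x : enorm x ^+ 2 = edot x x.
Proof. by rewrite sqr_sqrtr// edot_ge0. Qed.

Lemma enorm_gt0 x : x != 0 -> 0 < enorm x.
Proof.
move=> x0; rewrite sqrtr_gt0 lt_neqAle edot_ge0 andbT eq_sym.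
by apply: contra x0 => /eqP/edot_eq0->.
Qed.

Lemma enormZ a x : 0 <= a -> enorm (a *: x) = a * enorm x.
Proof.
move=> a0; rewrite /enorm edotZl edotZr mulrA -expr2 sqrtrM ?sqr_ge0//.
by rewrite sqrtr_sqr ger0_norm.
Qed.

Lemma enorm_eq1 x : enorm x = 1 <-> edot x x = 1.
Proof.
split=> [x1|x1]; first by rewrite -sqr_enorm x1 expr1n.
by rewrite /enorm x1 sqrtr1.
Qed.

End EuclideanRows.

Section Sphere.
Context {R : realType} {n : nat}.
Local Open Scope classical_set_scope.
Local Notation X := 'rV[R]_n.+1.
Implicit Types (x y e : X).

Lemma sphereP x : @sphere R n x <-> edot x x = 1.
Proof. exact: enorm_eq1. Qed.

Lemma sphere_neq0 x : sphere x -> x != 0.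
Proof.
move=> /sphereP x1; apply/eqP => x0; move: x1; rewrite x0 /edot big1.
  by move/esym/eqP; rewrite oner_eq0.
by move=> i _; rewrite mxE mul0r.
Qed.

Lemma punctured_open : open (@punctured R n).
Proof.
have -> : @punctured R n = ~` [set 0].
  by apply/seteqP; split => y /=; [move/eqP | move=> y0; apply/eqP].
apply/closed_openC/accessible_closed_set1/hausdorff_accessible.
exact: norm_hausdorff.
Qed.

Lemma sphere_compact : compact (@sphere R n).
Proof.
have ce : continuous (fun y : X => edot y y).
  have -> : (fun y : X => edot y y) = \sum_i (fun y : X => y 0 i * y 0 i).
    by apply/funext => y; rewrite fct_sumE.
  move=> y; apply: differentiable_continuous; apply: differentiable_sum => i.
  by apply: differentiableM; exact: differentiable_coord.
apply: bounded_closed_compact.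
  exists 1; split=> // M M1 y /sphereP y1; apply: mx_norm_le; first lra.
  move=> i; apply: le_trans (ltW M1); rewrite -(@ler_pXn2r _ 2) ?nnegrE//.
  rewrite real_normK ?num_real// expr1n -y1 /edot (bigD1 i)//= -expr2 lerDl.
  by apply: sumr_ge0 => j _; rewrite -expr2 sqr_ge0.
have -> : @sphere R n = (fun y : X => edot y y) @^-1` [set 1].
  by apply/seteqP; split => y /sphereP.
by apply: closed_comp => [y _|]; [exact: ce | exact: closed_eq].
Qed.

Definition great_circle x e (t : R) : X := cos t *: x + sin t *: e.

Lemma great_circle0 x e : great_circle x e 0 = x.
Proof. by rewrite /great_circle cos0 sin0 scale1r scale0r addr0. Qed.

Lemma is_derive_great_circle x e (t : R) i :
  is_derive t 1 (fun s => great_circle x e s 0 i)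
    ((- sin t *: x + cos t *: e) 0 i).
Proof.
have -> : (fun s => great_circle x e s 0 i) = (fun s => cos s * x 0 i + sin s * e 0 i).
  by apply/funext => s; rewrite !mxE.
rewrite !mxE; apply: is_derive_add.
  by apply: is_derive_eq (is_derive_mul (is_derive_cos t) (is_derive_cst_fun t _)) _; ring.
by apply: is_derive_eq (is_derive_mul (is_derive_sin t) (is_derive_cst_fun t _)) _; ring.
Qed.

Lemma great_circle_sphere x e t : edot x x = 1 -> edot e e = 1 -> edot x e = 0 ->
  sphere (great_circle x e t).
Proof.
move=> x1 e1 xe; apply/sphereP.
rewrite !(edotDl, edotDr, edotZl, edotZr) (edotC e x) x1 e1 xe.
by have := cos2Dsin2 t; lra.
Qed.

(* Rotating the frame [E] by the rotation of the plane [(x, e)] that carries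
   [x] to [great_circle x e t]. *)
Definition rotated_frame x e (E : 'M[R]_(n.+1, n)) (t : R) : 'M[R]_(n.+1, n) :=
  E + ((cos t - 1) *: e - sin t *: x)^T *m (e *m E).

Lemma rotated_frame0 x e E : rotated_frame x e E 0 = E.
Proof.
by rewrite /rotated_frame cos0 sin0 subrr !scale0r subrr trmx0 mul0mx addr0.
Qed.

(** The vector [w] is the displacement of [e] under the rotation. Since w E = (cos t - 1) e E and
    |w|^2 = 2 - 2 cos t, the corrections to the Gram matrix cancel. *)
Lemma tframe_rotated x e E t : edot x x = 1 -> edot e e = 1 -> edot x e = 0 ->
  tframe x E -> tframe (great_circle x e t) (rotated_frame x e E t).
Proof.
move=> x1 e1 xe [EE xE]; rewrite /tframe /rotated_frame /great_circle.
set w := _ - _; set r := e *m E.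
have wE : w *m E = (cos t - 1) *: r.
  by rewrite mulmxBl -!scalemxAl xE scaler0 subr0.
have ww : edot w w = 2 - 2 * cos t.
  rewrite /w -scaleNr !(edotDl, edotDr, edotZl, edotZr) (edotC e x) x1 e1 xe.
  by have := cos2Dsin2 t; lra.
have xw : edot x w = - sin t.
  by rewrite /w -scaleNr !(edotDr, edotZr) x1 xe; ring.
have ew : edot e w = cos t - 1.
  by rewrite /w -scaleNr !(edotDr, edotZr) (edotC e x) e1 xe; ring.
clearbody w; split.
  rewrite [(_ + _)^T]raddfD/= trmx_mul trmxK mulmxDl !mulmxDr EE.
  have -> : E^T *m (w^T *m r) = (cos t - 1) *: (r^T *m r).
    by rewrite mulmxA -trmx_mul wE linearZ/= -scalemxAl.
  have -> : r^T *m w *m E = (cos t - 1) *: (r^T *m r).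
    by rewrite -mulmxA wE -scalemxAr.
  rewrite -mulmxA (mulmxA w) mulmx_tr_edot ww mul_scalar_mx -scalemxAr.
  rewrite -!addrA -!scalerDl -[RHS]addr0; congr (_ + _).
  by rewrite -[RHS](scale0r (r^T *m r)); congr (_ *: _); ring.
rewrite mulmxDr mulmxDl -!scalemxAl xE scaler0 add0r -/r mulmxA mulmx_tr_edot.
rewrite mul_scalar_mx -scalerDl !(edotDl, edotZl) xw ew.
by rewrite -[RHS](scale0r r); congr (_ *: _); ring.
Qed.

(* A Householder reflection carries the first basis vector to [x]. *)
Lemma tframe_exists x : edot x x = 1 -> exists E, tframe x E.
Proof.
move=> x1; pose a : X := ev R 0.
have a1 : edot a a = 1.
  rewrite /edot (bigD1 0)//= !mxE eqxx mulr1 big1 ?addr0// => i i0.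
  by rewrite !mxE eq_sym (negbTE i0) mulr0.
have [H HH xH] : exists2 H : 'M[R]_n.+1, H^T *m H = 1%:M & x *m H = a.
  have [->|xa] := eqVneq x a; first by exists 1%:M; rewrite ?trmx1 ?mulmx1.
  pose v := x - a; pose c := 2 / edot v v.
  have vv : edot v v = 2 - 2 * edot x a.
    rewrite /v -scaleN1r !(edotDl, edotDr, edotZl, edotZr) (edotC a x) x1 a1; ring.
  have vv0 : edot v v != 0.
    by apply: contra xa => /eqP/edot_eq0/eqP; rewrite subr_eq0.
  have xv : edot x v = edot v v / 2.
    by rewrite vv /v -scaleN1r edotDr edotZr x1; field.
  exists (1%:M - c *: (v^T *m v)).
    set Q := v^T *m v; have QT : Q^T = Q by rewrite trmx_mul trmxK.
    have QQ : Q *m Q = edot v v *: Q.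
      by rewrite mulmxA -(mulmxA v^T) mulmx_tr_edot mul_mx_scalar -scalemxAl.
    rewrite [(_ - _)^T]raddfB/= linearZ/= QT trmx1 mulmxBl !mulmxBr !mul1mx mulmx1.
    rewrite -!scalemxAl -!scalemxAr QQ !scalerA.
    have -> : c * c * edot v v = c + c by rewrite /c; field.
    by rewrite scalerDl opprB addrK subrK.
  rewrite mulmxBr mulmx1 -scalemxAr mulmxA mulmx_tr_edot mul_scalar_mx scalerA xv.
  have -> : c * (edot v v / 2) = 1 by rewrite /c; field.
  by rewrite scale1r /v subKr.
(* The columns of [J] are the basis vectors other than the first, so x H J = a J = 0. *)
pose J : 'M[R]_(n.+1, n) := \matrix_(i, j) (i == lift 0 j)%:R.
exists (H *m J); split.
  rewrite trmx_mul mulmxA -(mulmxA J^T) HH mulmx1; apply/matrixP => i j.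
  rewrite !mxE (bigD1 (lift 0 i))//= !mxE eqxx mul1r big1 ?addr0.
    by rewrite (inj_eq lift_inj).
  by move=> k ki; rewrite !mxE (negbTE ki) mul0r.
rewrite mulmxA xH; apply/rowP => j; rewrite !mxE big1// => i _; rewrite !mxE.
by case: eqP => [<-|_]; rewrite ?mul0r// (negbTE (neq_lift _ _)) mulr0.
Qed.

End Sphere.

(** * Conditions at a maximum of the logarithmic gradient *)

Section LogGradient.
Context {R : realType} {m : nat} (D : set 'rV[R]_m) (oD : open D).
Context (U : 'rV[R]_m -> R) (U0 : forall y, D y -> U y != 0) (UC : Ck 3 D U).

Definition logpd (i : 'I_m) (y : 'rV[R]_m) : R := pd U i y * (U y)^-1.

Lemma logpd_C2 i : Ck 2 D (logpd i).
Proof.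
apply: (CkM oD); first exact: CkS_pd UC.
by apply: (CkV oD) => //; exact: (CkW UC).
Qed.

Lemma pd_pd_logpd i j y : D y ->
  pd (pd U i) j y = U y * (pd (logpd i) j y + logpd i y * logpd j y).
Proof.
move=> Dy; have [_ dU] := UC; have [dUj _] := dU j.
have [_ [_ /(_ j)[dUij _]]] := dU i.
have dV : derivable (fun y => (U y)^-1) y (ev R j).
  exact: derivableV (U0 Dy) (dUj y Dy).
rewrite {1}/logpd (pdM (dUij y Dy) dV) (pdV (U0 Dy) (dUj y Dy)) /logpd.
have := U0 Dy; move: (U y) (pd U i y) (pd U j y) (pd (pd U i) j y) => a b c d a0.
by field.
Qed.

Lemma logpd_sym i j y : D y -> pd (logpd i) j y = pd (logpd j) i y.
Proof.
move=> Dy; have := pd_comm i j oD Dy (CkW UC).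
rewrite (pd_pd_logpd i j Dy) (pd_pd_logpd j i Dy) => /(mulfI (U0 Dy)).
by rewrite [logpd j y * logpd i y]mulrC => /addIr.
Qed.

End LogGradient.

(** * First and second variation along great circles *)

Section MaximumConditions.
Context {R : realType} {n : nat}.
Local Open Scope classical_set_scope.
Local Notation X := 'rV[R]_n.+1.
Local Notation D := (@punctured R n).
Context (V : 'I_n.+1 -> X -> R).
Hypothesis VC : forall i, Ck 2 D (V i).
Hypothesis Vsym : forall i j y, D y -> pd (V i) j y = pd (V j) i y.
Hypothesis Veuler : forall y : X, D y -> \sum_i y 0 i * V i y = 0.

Let oD : open D := @punctured_open R n.

(** Symmetry of DV and Schwarz's theorem make D^2 V symmetric in all three indices. *)
Lemma pd3_rot i j k y : D y -> pd (pd (V i) j) k y = pd (pd (V k) i) j y.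
Proof.
move=> Dy; rewrite (pd_comm j k oD Dy (VC i)).
by apply: (pd_ext oD _ Dy) => z Dz; exact: Vsym.
Qed.

(** Differentiating [Veuler] in the direction [i] gives V_i + sum_k y_k d_i V_k = 0, and [Vsym]
    exchanges the indices. This is Euler's relation for degree -1. *)
Lemma pdiff_euler i y : D y -> pdiff (V i) y y = - V i y.
Proof.
move=> Dy; pose c (s : R) : X := y + s *: ev R i.
have c0 : c 0 = y by rewrite /c scale0r addr0.
have dc k : is_derive (0 : R) 1 (fun s => c s 0 k) ((ev R i : X) 0 k).
  have -> : (fun s => c s 0 k) = (fun s => y 0 k + s * (ev R i : X) 0 k).
    by apply/funext => s; rewrite !mxE.
  apply: is_derive_eq (is_derive_add (is_derive_cst_fun 0 _)
    (is_derive_mul (is_derive_id (0 : R) 1) (is_derive_cst_fun 0 _))) _.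
  by rewrite mulr0 addr0 add0r mul1r.
have dV k : is_derive (0 : R) 1 (V k \o c) (pdiff (V k) (c 0) (ev R i)).
  by apply: (is_derive_curve oD) => //; [rewrite c0 | exact: CkW].
have dS := is_derive_bigsum (fun k => is_derive_mul (dc k) (dV k)).
have d0 : is_derive (0 : R) 1 (fun s => \sum_k c s 0 k * (V k \o c) s) 0.
  apply: near_eq_is_derive (is_derive_cst_fun 0 0).
  have /nbhs_normP[r /= r0 H] := open_nbhs_nbhs (conj oD Dy).
  apply/nbhs_normP; exists r => //= s; rewrite /ball_/= sub0r normrN => sr.
  rewrite Veuler//; apply: H; rewrite /ball_/= opprD addNKr normrN normrZ.
  apply: le_lt_trans sr; rewrite -[leRHS]mulr1 ler_wpM2l//.
  by apply: mx_norm_le => // l; rewrite mxE; case: eqP; rewrite ?normr1 ?normr0.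
have [_ E1] := dS; have [_ E2] := d0; move: E1; rewrite E2 {E2} /= c0.
have pe k : pdiff (V k) y (ev R i) = pd (V k) i y.
  rewrite /pdiff (bigD1 i)//= mxE eqxx mul1r big1 ?addr0// => l li.
  by rewrite mxE eq_sym (negbTE li) mul0r.
rewrite big_split/= (bigD1 i)//= big1 ?addr0; last first.
  by move=> l li; rewrite mxE eq_sym (negbTE li) mul0r.
rewrite mxE eqxx mul1r => /esym/eqP; rewrite addrC addr_eq0 => /eqP <-.
by apply: eq_bigr => k _; rewrite pe Vsym.
Qed.

Context (x : X) (x1 : edot x x = 1).
Definition sqnorm y := \sum_i V i y ^+ 2.
Hypothesis xmax : forall y, sphere y -> sqnorm y <= sqnorm x.

Let Dx : D x. Proof. exact/sphere_neq0/sphereP. Qed.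

Lemma is_derive_along (f : X -> R) (e : X) (t : R) :
  edot e e = 1 -> edot x e = 0 -> Ck 1 D f ->
  is_derive t 1 (f \o great_circle x e)
    (pdiff f (great_circle x e t) (- sin t *: x + cos t *: e)).
Proof.
move=> e1 xe fC; apply: (is_derive_curve oD) => //.
  exact/sphere_neq0/great_circle_sphere.
exact: is_derive_great_circle.
Qed.

Lemma is_derive_along0 (f : X -> R) (e : X) : edot e e = 1 -> edot x e = 0 -> Ck 1 D f ->
  is_derive (0 : R) 1 (f \o great_circle x e) (pdiff f x e).
Proof.
move=> e1 xe fC; have := is_derive_along 0 e1 xe fC.
by rewrite great_circle0 sin0 cos0 oppr0 scale0r scale1r add0r.
Qed.

Lemma is_derive_sqnorm (e : X) (t : R) : edot e e = 1 -> edot x e = 0 ->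
  is_derive t 1 (sqnorm \o great_circle x e)
    (\sum_i 2 * (V i (great_circle x e t) *
      pdiff (V i) (great_circle x e t) (- sin t *: x + cos t *: e))).
Proof.
move=> e1 xe; have dV i := is_derive_along t e1 xe (CkW (VC i)).
apply: is_derive_eq (is_derive_bigsum (fun i => is_derive_mul (dV i) (dV i))) _.
by apply: eq_bigr => i _; rewrite /=; ring.
Qed.

(** These are halves of the first two derivatives of [sqnorm] along the great circle at [0]. The
    acceleration of the circle is -x, and -DV(x) = V by [pdiff_euler], whence the extra term
    [sqnorm x]. *)
Lemma max_conditions (e : X) : edot e e = 1 -> edot x e = 0 ->
  \sum_i V i x * pdiff (V i) x e = 0 /\
  \sum_i pdiff (V i) x e ^+ 2 +
    \sum_i V i x * (\sum_j e 0 j * pdiff (pd (V i) j) x e) + sqnorm x <= 0.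
Proof.
move=> e1 xe; pose gc := great_circle x e.
pose df t := \sum_i 2 * (V i (gc t) * pdiff (V i) (gc t) (- sin t *: x + cos t *: e)).
have dV i := is_derive_along0 e1 xe (CkW (VC i)).
have dpV i j := is_derive_along0 e1 xe (CkS_pd j (VC i)).
pose q i := V i x + \sum_j e 0 j * pdiff (pd (V i) j) x e.
have dP i : is_derive (0 : R) 1
    (fun t => pdiff (V i) (gc t) (- sin t *: x + cos t *: e)) (q i).
  have -> : (fun t => pdiff (V i) (gc t) (- sin t *: x + cos t *: e)) =
     (fun t => \sum_j (- sin t * x 0 j + cos t * e 0 j) * (pd (V i) j \o gc) t).
    by apply/funext => t; apply: eq_bigr => j _; rewrite !mxE.
  have dc j : is_derive (0 : R) 1 (fun t => - sin t * x 0 j + cos t * e 0 j) (- x 0 j).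
    apply: is_derive_eq (is_derive_add
      (is_derive_mul (is_deriveN (is_derive_sin (0 : R))) (is_derive_cst_fun 0 _))
      (is_derive_mul (is_derive_cos (0 : R)) (is_derive_cst_fun 0 _))) _.
    by rewrite cos0 sin0; ring.
  apply: is_derive_eq (is_derive_bigsum (fun j => is_derive_mul (dc j) (dpV i j))) _.
  rewrite big_split/= /q; congr (_ + _).
    rewrite -[RHS]opprK -pdiff_euler// /pdiff -sumrN; apply: eq_bigr => j _.
    by rewrite /gc great_circle0 mulNr.
  by apply: eq_bigr => j _; rewrite sin0 cos0; congr (_ * _); ring.
have d2 : is_derive (0 : R) 1 df
    (\sum_i 2 * (pdiff (V i) x e * pdiff (V i) x e + V i x * q i)).
  apply: is_derive_bigsum => i.
  apply: is_derive_eq (is_derive_mul (is_derive_cst_fun 0 2)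
    (is_derive_mul (dV i) (dP i))) _.
  by rewrite mul0r add0r /gc /= great_circle0 sin0 cos0 oppr0 scale0r scale1r add0r.
have [||] := second_derivative_at_max (f := sqnorm \o gc) _ d2.
- by move=> s; exact: is_derive_sqnorm.
- move=> s; rewrite /= /gc great_circle0; apply: xmax.
  exact: great_circle_sphere.
rewrite /df /gc great_circle0 sin0 cos0 oppr0 scale0r scale1r add0r -!mulr_sumr.
move=> /eqP; rewrite mulf_eq0 pnatr_eq0/= => /eqP -> le; split=> //.
rewrite -(@pmulr_rle0 _ 2)//; apply: le_trans le.
rewrite ler_pM2l// -big_split -big_split/= /sqnorm le_eqVlt; apply/orP; left; apply/eqP.
by apply: eq_bigr => i _; rewrite /q /=; ring.
Qed.

Context (E : 'M[R]_(n.+1, n)) (Efr : tframe x E) (pos : 0 < sqnorm x).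
Let b := Num.sqrt (sqnorm x).
Definition max_direction : X := (Num.sqrt (sqnorm x))^-1 *: (\row_i V i x).
Let e := max_direction.
Let r := e *m E.

Let b_gt0 : 0 < b. Proof. by rewrite sqrtr_gt0. Qed.

Let VE i : V i x = b * e 0 i.
Proof. by rewrite !mxE mulVKf// gt_eqF. Qed.

Let bb : b ^+ 2 = sqnorm x. Proof. by rewrite sqr_sqrtr// ltW. Qed.

Lemma max_direction_unit : edot e e = 1.
Proof.
have b0 : b ^+ 2 != 0 by rewrite expf_neq0// gt_eqF.
apply: (mulfI b0); rewrite mulr1 {2}bb /edot /sqnorm mulr_sumr.
by apply: eq_bigr => i _; rewrite VE; ring.
Qed.

Lemma max_direction_tangent : edot x e = 0.
Proof.
rewrite edotZr; have -> : edot x (\row_i V i x) = 0; last by rewrite mulr0.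
by rewrite -(Veuler Dx); apply: eq_bigr => i _; rewrite mxE.
Qed.

Let e1 := max_direction_unit.
Let xe := max_direction_tangent.

(** For [V = logpd U] this is the Hessian of [U] divided by [U], by [pd_pd_logpd]. *)
Definition log_hessian y : 'M[R]_n.+1 :=
  \matrix_(i, j) (pd (V i) j y + V i y * V j y).

Definition frame_hessian t : 'M[R]_n :=
  (rotated_frame x e E t)^T *m log_hessian (great_circle x e t)
    *m rotated_frame x e E t.

Let P : 'M[R]_n.+1 := \matrix_(i, j) pdiff (pd (V i) j) x e.

Definition frame_hessian_derivative : 'M[R]_n :=
  E^T *m P *m E + (2 * b) *: (r^T *m r).

Let sum_x_hessian j : \sum_i x 0 i * log_hessian x i j = - V j x.
Proof.
rewrite -pdiff_euler//.
under eq_bigr do rewrite mxE mulrDr mulrA.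
rewrite big_split/= -mulr_suml Veuler// mul0r addr0.
by apply: eq_bigr => i _; rewrite Vsym.
Qed.

Let sum_hessian_x i : \sum_j log_hessian x i j * x 0 j = - V i x.
Proof.
rewrite -sum_x_hessian; apply: eq_bigr => j _.
by rewrite mulrC !mxE [V i x * _]mulrC Vsym.
Qed.

Let sum_VE a : \sum_i V i x * E i a = b * r 0 a.
Proof. by rewrite /r [in RHS]mxE mulr_sumr; apply: eq_bigr => i _; rewrite VE mulrA. Qed.

(** The first order condition along column [a] of [E], a unit tangent vector, with V = b e and the
    indices exchanged by [Vsym]. *)
Let sum_pdiffE a : \sum_i pdiff (V i) x e * E i a = 0.
Proof.
have [EE xE] := Efr; pose xi : X := (col a E)^T.
have xi1 : edot xi xi = 1.
  have := congr1 (fun M : 'M[R]_n => M a a) EE; rewrite !mxE eqxx mulr1n => <-.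
  by apply: eq_bigr => i _; rewrite !mxE.
have xxi : edot x xi = 0.
  have := congr1 (fun M : 'rV[R]_n => M 0 a) xE; rewrite !mxE => <-.
  by apply: eq_bigr => i _; rewrite !mxE.
have [E0 _] := max_conditions xi1 xxi.
have b0 : b != 0 by rewrite gt_eqF.
suff : b * (\sum_i pdiff (V i) x e * E i a) = 0.
  by move/eqP; rewrite mulf_eq0 (negbTE b0) => /eqP.
rewrite -[RHS]E0 mulr_sumr /pdiff.
under eq_bigr do rewrite mulr_suml mulr_sumr.
under [RHS]eq_bigr do rewrite mulr_sumr.
rewrite [RHS]exchange_big/=; apply: eq_bigr => i _; apply: eq_bigr => j _.
by rewrite (VE j) [xi _ _]mxE [col _ _ _ _]mxE (Vsym i j Dx); ring.
Qed.

(** By [sum_pdiffE] the derivative of V V^T contributes nothing. The frame has velocity -x^T r, and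
    contracting [log_hessian] with [x] gives -V, so each of the two frame factors contributes b r^T
    r; hence the coefficient [2 * b]. *)
Lemma is_derive_frame_hessian a c :
  is_derive (0 : R) 1 (fun t => frame_hessian t a c) (frame_hessian_derivative a c).
Proof.
have dF k d : is_derive (0 : R) 1 (fun t => rotated_frame x e E t k d) (- x 0 k * r 0 d).
  have -> : (fun t => rotated_frame x e E t k d) =
      (fun t => E k d + ((cos t - 1) * e 0 k + - sin t * x 0 k) * r 0 d).
    apply/funext => t; rewrite /rotated_frame -/r mxE; congr (_ + _).
    by rewrite mxE big_ord1 !mxE mulNr.
  apply: is_derive_eq (is_derive_add (is_derive_cst_fun 0 _) (is_derive_mul
    (is_derive_add
      (is_derive_mul (is_derive_add (is_derive_cos (0 : R)) (is_derive_cst_fun 0 _))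
        (is_derive_cst_fun 0 _))
      (is_derive_mul (is_deriveN (is_derive_sin (0 : R))) (is_derive_cst_fun 0 _)))
    (is_derive_cst_fun 0 _))) _.
  by rewrite sin0 cos0; ring.
have dN i j : is_derive (0 : R) 1 (fun t => log_hessian (great_circle x e t) i j)
    (P i j + (pdiff (V i) x e * V j x + V i x * pdiff (V j) x e)).
  have -> : (fun t => log_hessian (great_circle x e t) i j) =
      (fun t => (pd (V i) j \o great_circle x e) t +
                (V i \o great_circle x e) t * (V j \o great_circle x e) t).
    by apply/funext => t; rewrite mxE.
  have dV k := is_derive_along0 e1 xe (CkW (VC k)).
  rewrite mxE; apply: is_derive_eq (is_derive_add
    (is_derive_along0 e1 xe (CkS_pd j (VC i))) (is_derive_mul (dV i) (dV j))) _.
  by rewrite /= great_circle0.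
have -> : (fun t => frame_hessian t a c) = (fun t => \sum_j (\sum_i
    rotated_frame x e E t i a * log_hessian (great_circle x e t) i j)
      * rotated_frame x e E t j c).
  apply/funext => t; rewrite /frame_hessian mxE; apply: eq_bigr => j _.
  by rewrite mxE; congr (_ * _); apply: eq_bigr => i _; rewrite mxE.
apply: is_derive_eq (is_derive_bigsum (fun j => is_derive_mul
  (is_derive_bigsum (fun i => is_derive_mul (dF i a) (dN i j))) (dF j c))) _.
rewrite great_circle0 rotated_frame0.
have -> : frame_hessian_derivative a c =
    \sum_j (\sum_i E i a * P i j) * E j c + 2 * b * r 0 a * r 0 c.
  rewrite /frame_hessian_derivative !mxE; congr (_ + _); last first.
    by rewrite big_ord1 !mxE mulrA.
  apply: eq_bigr => j _; rewrite mxE; congr (_ * _).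
  by apply: eq_bigr => i _; rewrite mxE.
transitivity (\sum_j ((\sum_i E i a * P i j) * E j c + r 0 a * (V j x * E j c)
   - r 0 c * (\sum_i E i a * log_hessian x i j * x 0 j)
   + (\sum_i pdiff (V i) x e * E i a) * (V j x * E j c)
   + (\sum_i V i x * E i a) * (pdiff (V j) x e * E j c))).
  apply: eq_bigr => j _; rewrite big_split/=.
  have -> : \sum_i - x 0 i * r 0 a * log_hessian x i j = r 0 a * V j x.
    rewrite -[V j x]opprK -sum_x_hessian mulrN -mulNr mulr_sumr.
    by apply: eq_bigr => i _; ring.
  have -> : \sum_i E i a * (P i j + (pdiff (V i) x e * V j x + V i x * pdiff (V j) x e))
     = \sum_i E i a * P i j + (\sum_i pdiff (V i) x e * E i a) * V j x
       + (\sum_i V i x * E i a) * pdiff (V j) x e.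
    by rewrite !mulr_suml -!big_split/=; apply: eq_bigr => i _; ring.
  by rewrite -mulr_suml; ring.
rewrite !big_split/= sumrN -!mulr_sumr !sum_VE !sum_pdiffE.
have -> : \sum_j \sum_i E i a * log_hessian x i j * x 0 j = - (b * r 0 a).
  rewrite exchange_big/= -sum_VE -sumrN; apply: eq_bigr => i _.
  by under eq_bigr do rewrite -mulrA; rewrite -mulr_sumr sum_hessian_x; ring.
ring.
Qed.

(** Let s = <e, xi>. After [pd3_rot] the second order condition reads |DV(xi)|^2 + b P(xi, xi) + b^2
    <= 0. The component of DV(xi) along [x] is -b s, so |DV(xi)|^2 >= b^2 s^2, and b times the form
    is at most -b^2 (1 - s^2). *)
Lemma frame_hessian_derivative_unit_le0 (z : 'rV[R]_n) : edot z z = 1 ->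
  (z *m frame_hessian_derivative *m z^T) 0 0 <= 0.
Proof.
have [EE xE] := Efr; move=> z1; pose xi : X := z *m E^T.
have xi1 : edot xi xi = 1.
  by rewrite edot_mulmx trmx_mul trmxK mulmxA -(mulmxA z) EE mulmx1 -edot_mulmx.
have xxi : edot x xi = 0.
  by rewrite edot_mulmx trmx_mul trmxK mulmxA xE mul0mx mxE.
have -> : (z *m frame_hessian_derivative *m z^T) 0 0 =
    (\sum_i \sum_j xi 0 i * xi 0 j * P i j) + 2 * b * edot e xi ^+ 2.
  rewrite mulmxDr mulmxDl mxE; congr (_ + _).
    have -> : z *m (E^T *m P *m E) *m z^T = xi *m P *m xi^T.
      by rewrite trmx_mul trmxK !mulmxA.
    rewrite exchange_big mxE; apply: eq_bigr => j _; rewrite [xi^T _ _]mxE mxE mulr_suml.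
    by apply: eq_bigr => i _; ring.
  have rz : r *m z^T = (edot e xi)%:M.
    by rewrite -mulmx_tr_edot trmx_mul trmxK mulmxA.
  have zr : z *m r^T = (edot e xi)%:M.
    by rewrite -[LHS]trmxK trmx_mul trmxK rz tr_scalar_mx.
  rewrite -scalemxAr -scalemxAl mxE mulmxA zr -mulmxA rz -scalar_mxM mxE eqxx mulr1n.
  by rewrite expr2.
rewrite -(pmulr_rle0 _ b_gt0).
have [_] := max_conditions xi1 xxi.
have -> : \sum_i V i x * (\sum_j xi 0 j * pdiff (pd (V i) j) x xi) =
    b * (\sum_i \sum_j xi 0 i * xi 0 j * P i j).
  rewrite mulr_sumr.
  transitivity (\sum_k \sum_i \sum_j V k x * (xi 0 i * (xi 0 j * pd (pd (V i) j) k x))).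
    apply: eq_bigr => k _; rewrite mulr_sumr; apply: eq_bigr => i _.
    rewrite /pdiff !mulr_sumr; apply: eq_bigr => j _.
    by rewrite (pd3_rot i j k Dx).
  rewrite exchange_big; apply: eq_bigr => i _.
  rewrite exchange_big mulr_sumr; apply: eq_bigr => j _.
  rewrite [P i j]mxE /pdiff !mulr_sumr; apply: eq_bigr => k _.
  by rewrite VE; ring.
pose w : X := \row_i pdiff (V i) x xi.
have -> : \sum_i pdiff (V i) x xi ^+ 2 = edot w w.
  by apply: eq_bigr => i _; rewrite [w _ _]mxE expr2.
have := edot_unit_le w x1; have := edot_unit_le xi e1.
have -> : edot x w = - (b * edot e xi).
  transitivity (\sum_j xi 0 j * pdiff (V j) x x).
    rewrite /edot /pdiff.
    under eq_bigr do rewrite [w _ _]mxE mulr_sumr.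
    under [RHS]eq_bigr do rewrite mulr_sumr.
    rewrite exchange_big; apply: eq_bigr => j _; apply: eq_bigr => i _.
    by rewrite (Vsym i j Dx); ring.
  rewrite /edot mulr_sumr -sumrN; apply: eq_bigr => j _.
  by rewrite pdiff_euler// VE; ring.
rewrite xi1 -bb sqrrN.
move: (edot w w) (edot e xi) (\sum_i _) => W s Q.
have : 0 <= b ^+ 2 by exact: sqr_ge0.
move: b => B B2 s1 BsW le.
have : 0 <= B ^+ 2 * (1 - s ^+ 2) by rewrite mulr_ge0// subr_ge0.
move: BsW le; rewrite exprMn; lra.
Qed.

Lemma frame_hessian_derivative_le0 (z : 'rV[R]_n) :
  (z *m frame_hessian_derivative *m z^T) 0 0 <= 0.
Proof.
have [->|z0] := eqVneq z 0; first by rewrite !mul0mx mxE.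
have nz : 0 < enorm z by exact: enorm_gt0.
pose w := (enorm z)^-1 *: z.
have w1 : edot w w = 1.
  by rewrite edotZl edotZr -sqr_enorm; field; rewrite gt_eqF.
have zE : z = enorm z *: w by rewrite scalerA mulfV ?scale1r// gt_eqF.
clearbody w; have -> : (z *m frame_hessian_derivative *m z^T) 0 0 =
    enorm z ^+ 2 * (w *m frame_hessian_derivative *m w^T) 0 0.
  rewrite [in LHS]zE [(_ *: w)^T]linearZ/= -!scalemxAl -scalemxAr scalerA.
  by rewrite [LHS]mxE expr2.
by rewrite pmulr_rle0 ?exprn_gt0//; exact: frame_hessian_derivative_unit_le0.
Qed.

End MaximumConditions.

(** * The estimate *)

Section Forms.
Context {R : realType} {n : nat}.
Local Open Scope classical_set_scope.

Lemma form_bound (M : 'M[R]_n) (eta : R) (z : 'rV[R]_n) :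
  (forall a c, `|M a c| <= eta) ->
  (z *m M *m z^T) 0 0 <= eta * n%:R * edot z z.
Proof.
move=> Mle.
have -> : (z *m M *m z^T) 0 0 = \sum_c \sum_a z 0 a * M a c * z 0 c.
  by rewrite mxE; apply: eq_bigr => c _; rewrite !mxE mulr_suml.
have -> : eta * n%:R * edot z z =
    \sum_(c < n) \sum_(a < n) eta / 2 * (z 0 a * z 0 a + z 0 c * z 0 c).
  under eq_bigr do rewrite -mulr_sumr big_split/= sumr_const card_ord.
  rewrite -mulr_sumr big_split/= sumr_const card_ord sumrMnl -/(edot z z).
  by rewrite -(mulr_natr (edot z z)); field.
apply: ler_sum => c _; apply: ler_sum => a _.
have := Mle a c; rewrite ler_norml => /andP[lo hi].
move: (M a c) (z 0 a) (z 0 c) lo hi => d s t lo hi.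
(* The sum of [h1] and [h2] says that 4 d s t <= 2 eta (s^2 + t^2). *)
have h1 : 0 <= (eta - d) * (s + t) ^+ 2 by rewrite mulr_ge0 ?sqr_ge0// subr_ge0.
have h2 : 0 <= (eta + d) * (s - t) ^+ 2.
  by rewrite mulr_ge0 ?sqr_ge0// -(opprK d) subr_ge0 lerNl.
move: h1 h2; lra.
Qed.

(** First order expansion at [0]; controlling the error entry by entry makes it uniform in [z], at
    the cost of the factor [n] from [form_bound]. *)
Lemma form_le_of_derive (A : R -> 'M[R]_n) (D : 'M[R]_n) :
  (forall a c, is_derive (0 : R) 1 (fun t => A t a c) (D a c)) ->
  (forall z : 'rV[R]_n, (z *m D *m z^T) 0 0 <= 0) ->
  forall e, 0 < e -> \forall t \near 0^'+, forall z : 'rV[R]_n,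
    (z *m A t *m z^T) 0 0 <= (z *m A 0 *m z^T) 0 0 + e * t * edot z z.
Proof.
move=> dA D0 e e0; pose eta := e / n.+1%:R.
have eta0 : 0 < eta by rewrite divr_gt0.
have N a c := is_derive_approx (dA a c) eta0.
have : \forall t \near (0 : R), forall a c,
    `|A (0 + t) a c - A 0 a c - D a c * t| <= eta * `|t|.
  have N' := fun a => filter_forall (nbhs_filter (0 : R)) (N a).
  exact (filter_forall (nbhs_filter (0 : R)) N').
move=> /nbhs_normP[r /= r0 H]; near=> t => z.
have t0 : 0 < t by near: t; exact: nbhs_right_gt.
have tr : t < r by near: t; exact: nbhs_right_lt.
have trn : `|0 - t| < r by rewrite sub0r normrN gtr0_norm.
have Ht := H t trn; rewrite /= add0r (gtr0_norm t0) in Ht.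
have B : (z *m (A t - A 0 - t *: D) *m z^T) 0 0 <= eta * t * n%:R * edot z z.
  by apply: form_bound => a c; rewrite !mxE [t * _]mulrC; exact: Ht.
have E : (z *m (A t - A 0 - t *: D) *m z^T) 0 0 = (z *m A t *m z^T) 0 0
    - (z *m A 0 *m z^T) 0 0 - t * (z *m D *m z^T) 0 0.
  rewrite !mulmxBr !mulmxBl -scalemxAr -scalemxAl.
  by move: (z *m A t *m z^T) (z *m A 0 *m z^T) (z *m D *m z^T) => a b c; rewrite !mxE.
have tD : t * (z *m D *m z^T) 0 0 <= 0 by rewrite pmulr_rle0.
have en : eta * t * n%:R * edot z z <= e * t * edot z z.
  rewrite ler_wpM2r ?edot_ge0// mulrAC ler_wpM2r ?(ltW t0)// /eta mulrAC -mulrA.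
  by rewrite ger_pMr// ler_pdivrMr// mul1r ler_nat.
rewrite E in B; move: B tD en.
move: (_ 0 0) (_ 0 0) (_ 0 0) (_ * edot z z) (e * t * _) => ? ? ? ? ?; lra.
Unshelve. all: by end_near. Qed.

End Forms.

(** * Degree-zero extensions and the matrix of the equation *)

Section HomogeneousExtension.
Context {R : realType} {n : nat}.
Local Open Scope classical_set_scope.
Local Notation X := 'rV[R]_n.+1.
Local Notation D := (@punctured R n).
Implicit Types (u : X -> R) (y : X).

Lemma hom0_sphere u y : sphere y -> hom0 u y = u y.
Proof. by move=> y1; rewrite /hom0 (_ : enorm y = 1)// invr1 scale1r. Qed.

Lemma hom0Z u y c : 0 < c -> hom0 u (c *: y) = hom0 u y.
Proof.
move=> c0; rewrite /hom0 enormZ ?ltW// scalerA invfM mulrAC mulVf ?mul1r//.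
by rewrite gt_eqF.
Qed.

Lemma normalized_sphere y : y != 0 -> sphere ((enorm y)^-1 *: y).
Proof.
move=> /enorm_gt0 y0; rewrite /sphere/= enormZ ?invr_ge0 ?ltW//.
by rewrite mulVf// gt_eqF.
Qed.

Lemma hom0_gt0 u : (forall x, sphere x -> 0 < u x) -> forall y, D y -> 0 < hom0 u y.
Proof. by move=> u0 y y0; exact/u0/normalized_sphere. Qed.

Lemma hom0_euler u y : Ck 1 D (hom0 u) -> D y -> pdiff (hom0 u) y y = 0.
Proof.
move=> uC Dy; pose c (s : R) : X := s *: y.
have dc i : is_derive (1 : R) 1 (fun s => c s 0 i) (y 0 i).
  have -> : (fun s => c s 0 i) = (fun s => s * y 0 i).
    by apply/funext => s; rewrite mxE.
  apply: is_derive_eq (is_derive_mul (is_derive_id (1 : R) 1) (is_derive_cst_fun 1 _)) _.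
  by rewrite mulr0 addr0 mul1r.
have c1 : c 1 = y by rewrite /c scale1r.
have d1 : is_derive (1 : R) 1 (hom0 u \o c) (pdiff (hom0 u) (c 1) y).
  by apply: (is_derive_curve (@punctured_open R n)) => //; rewrite c1.
have d0 : is_derive (1 : R) 1 (hom0 u \o c) 0.
  apply: near_eq_is_derive (is_derive_cst_fun 1 (hom0 u y)).
  near=> s; rewrite /= /c hom0Z//.
  by near: s; exact: lt_nbhsr.
by have [_ E1] := d1; have [_ E2] := d0; rewrite -E2 E1 c1.
Unshelve. all: by end_near. Qed.

Lemma pdiff_edot (f : X -> R) y h : pdiff f y h = edot h (\row_i pd f i y).
Proof. by apply: eq_bigr => i _; rewrite mxE. Qed.

(** The extension is constant along rays, so the radial correction in the Gauss formula vanishes.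
    The two Hessians list their indices in opposite orders, which [logpd_sym] reconciles. *)
Lemma sW_log_hessian u y (E : 'M[R]_(n.+1, n)) :
  Ck 3 D (hom0 u) -> (forall x, sphere x -> 0 < u x) -> sphere y ->
  sW u y E = u y *: (E^T *m log_hessian (logpd (hom0 u)) y *m E + 1%:M).
Proof.
move=> uC u0 ys; have Dy : D y by exact: sphere_neq0.
have U0 z : D z -> hom0 u z != 0 by move=> Dz; rewrite gt_eqF// hom0_gt0.
rewrite /sW /shess.
have -> : edot (sgrad u y) y = 0.
  by rewrite edotC -pdiff_edot hom0_euler//; exact: Ck_le uC.
rewrite raddf0 subr0 scalerDr scalemx1.
congr (_ + _); rewrite scalemxAl scalemxAr; congr (_ *m _ *m _).
apply/matrixP => i j; rewrite mxE [RHS]mxE [log_hessian _ _ _ _]mxE.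
rewrite -(hom0_sphere u ys) (logpd_sym (@punctured_open R n) U0 uC i j Dy).
by rewrite [logpd _ i y * _]mulrC; exact: (pd_pd_logpd U0 uC j i Dy).
Qed.

Lemma sgradnorm_sqnorm u y : (forall x, sphere x -> 0 < u x) -> sphere y ->
  sgradnorm u y ^+ 2 = u y ^+ 2 * sqnorm (logpd (hom0 u)) y.
Proof.
move=> u0 ys; rewrite /sgradnorm sqr_enorm /edot /sqnorm mulr_sumr.
apply: eq_bigr => i _; rewrite mxE /logpd hom0_sphere//; have := u0 y ys.
by move: (u y) (pd _ _ _) => a d a0; field; rewrite gt_eqF.
Qed.

End HomogeneousExtension.

(** The last factor on the left is the effect on sigma_k / sigma_l of dividing the eigenvalues by
    [a]. The exponents of [a] add up to (p - 1) + (k + 1 - q) + (l - k). *)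
Lemma powR_normalize (R : realType) (a s p q : R) (k l : nat) : 0 < a -> 0 <= s ->
  a `^ (p - 1) * (a ^+ 2 + a ^+ 2 * s) `^ ((k%:R + 1 - q) / 2)
    * (a^-1 ^+ k / a^-1 ^+ l) =
  a `^ (p - q + l%:R) * (1 + s) `^ ((k%:R + 1 - q) / 2).
Proof.
move=> a0 s0; rewrite -[X in X + _ * s]mulr1 -mulrDr powRM ?sqr_ge0 ?addr_ge0//.
rewrite -[a ^+ 2]powR_mulrn ?ltW// -powRrM.
have aD r t : a `^ (r + t) = a `^ r * a `^ t.
  by apply: powRD; rewrite (gt_eqF a0) implybT.
have -> : a^-1 ^+ k / a^-1 ^+ l = a `^ (l%:R - k%:R).
  by rewrite !exprVn invrK aD powRN !powR_mulrn ?ltW// mulrC.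
rewrite [X in X * _ = _]mulrA [LHS]mulrAC -!aD.
by congr (_ `^ _ * _); field.
Qed.

Lemma is_derive_powR_comp (R : realType) (f : R -> R) (f' a x : R) : 0 < f x ->
  is_derive x 1 f f' ->
  is_derive x 1 (fun s => f s `^ a) (a * f' * f x `^ a / f x).
Proof.
move=> fx fd; apply: is_derive_eq (is_derive1_comp (is_derive1_powR a fx) fd) _.
have -> : f x `^ a = f x `^ (a - 1) * f x.
  by rewrite -[X in _ = _ * X]powRr1 ?ltW// -powRD ?subrK// (gt_eqF fx) implybT.
by move: (f x) fx (_ `^ _) => y y0 w; field; rewrite gt_eqF.
Qed.

(** * The maximum principle along a great circle *)

Section GradientEstimate.
Context {R : realType} (n P k l : nat) (p q : R) (u phi : 'rV[R]_n.+1 -> R).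
Local Open Scope classical_set_scope.
Local Notation X := 'rV[R]_n.+1.
Local Notation D := (@punctured R n).
Hypothesis lk : (l < k)%N.
Hypothesis phiC : CkS 1 phi.
Hypothesis phi0 : forall x, sphere x -> 0 < phi x.
Hypothesis uC : CkS 3 u.
Hypothesis u0 : forall x, sphere x -> 0 < u x.
Hypothesis equation : forall x, sphere x -> forall E, tframe x E ->
  exists lam : 'I_n -> R,
    eigen_list (sW u x E) lam /\
    inGammaLambda P k lam /\
    sigmaLambda P k lam / sigmaLambda P l lam =
      u x `^ (p - 1) *
      (u x ^+ 2 + sgradnorm u x ^+ 2) `^ ((k%:R + 1 - q) / 2) * phi x.

Let V := logpd (hom0 u).
Let oD : open D := @punctured_open R n.
Let U_gt0 y : D y -> 0 < hom0 u y. Proof. exact: hom0_gt0. Qed.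
Let U0 y : D y -> hom0 u y != 0. Proof. by move=> Dy; rewrite gt_eqF// U_gt0. Qed.

Let VC i : Ck 2 D (V i). Proof. exact: logpd_C2. Qed.

Let Vsym i j y : D y -> pd (V i) j y = pd (V j) i y.
Proof. by move=> Dy; exact: (logpd_sym oD U0 uC i j Dy). Qed.

Let Veuler (y : X) : D y -> \sum_i y 0 i * V i y = 0.
Proof.
move=> Dy; transitivity (pdiff (hom0 u) y y / hom0 u y).
  by rewrite /pdiff mulr_suml; apply: eq_bigr => i _; rewrite /V /logpd mulrA.
by rewrite hom0_euler ?mul0r//; exact: Ck_le uC.
Qed.

Let sqnorm_ge0 y : 0 <= sqnorm V y.
Proof. by apply: sumr_ge0 => i _; exact: sqr_ge0. Qed.

Let alpha := p - q + l%:R.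
Let beta := (k%:R + 1 - q) / 2.

Lemma normalized_equation y E : sphere y -> tframe y E -> exists lam : 'I_n -> R,
  [/\ eigen_list (E^T *m log_hessian V y *m E + 1%:M) lam, inGammaLambda P k lam &
      sigmaLambda P k lam / sigmaLambda P l lam =
        hom0 u y `^ alpha * (1 + sqnorm V y) `^ beta * hom0 phi y].
Proof.
move=> ys fr; have [lam [el [G eq]]] := equation ys fr; have uy := u0 ys.
have ui : 0 < (u y)^-1 by rewrite invr_gt0.
exists (fun i => (u y)^-1 * lam i); split.
- have := eigen_list_affine 0 (lt0r_neq0 ui) el.
  rewrite (sW_log_hessian E uC u0 ys) raddf0 addr0 scalerA mulVf ?scale1r ?gt_eqF//.
  by under [X in eigen_list _ X]funext do rewrite addr0.
- exact: inGammaLambdaZ.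
- rewrite !sigmaLambdaZ !hom0_sphere//.
  rewrite /alpha /beta -powR_normalize// -sgradnorm_sqnorm//.
  rewrite invfM mulrACA eq; ring.
Qed.

Context (x : X) (xs : sphere x).
Hypothesis xmax : forall y, sphere y -> sqnorm V y <= sqnorm V x.
Hypothesis xpos : 0 < sqnorm V x.

Let b := Num.sqrt (sqnorm V x).
Let e := max_direction V x.
Let x1 : edot x x = 1. Proof. exact/sphereP. Qed.
Let e1 : edot e e = 1. Proof. exact: max_direction_unit. Qed.
Let xe : edot x e = 0. Proof. exact: max_direction_tangent. Qed.
Let gc := great_circle x e.
Let gcs t : sphere (gc t). Proof. exact: great_circle_sphere. Qed.
Let Dx : D x. Proof. exact: sphere_neq0. Qed.

Let rho t := hom0 u (gc t) `^ alpha * (1 + sqnorm V (gc t)) `^ beta * hom0 phi (gc t).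

(** Logarithmic differentiation: at [x] the gradient of log u is b e, which gives [alpha * b], and
    the factor in [sqnorm V] is stationary by the first order condition. *)
Lemma is_derive_rho :
  is_derive (0 : R) 1 rho (rho 0 * (alpha * b + pdiff (hom0 phi) x e / phi x)).
Proof.
have dU : is_derive (0 : R) 1 (hom0 u \o gc) (hom0 u x * b).
  have := is_derive_along0 x1 e1 xe (Ck_le (isT : (1 <= 3)%N) uC).
  suff -> : pdiff (hom0 u) x e = hom0 u x * b by [].
  have b0 : b != 0 by rewrite gt_eqF// sqrtr_gt0.
  have bb : b ^+ 2 = sqnorm V x by rewrite sqr_sqrtr.
  apply: (mulfI b0); rewrite mulrCA -expr2 bb /pdiff /sqnorm !mulr_sumr.
  apply: eq_bigr => i _; rewrite !mxE mulrA mulrA mulfV// mul1r.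
  rewrite /V /logpd; have := U0 Dx.
  by move: (hom0 u x) (pd (hom0 u) i x) => a d a0; field.
have dS : is_derive (0 : R) 1 (sqnorm V \o gc) 0.
  have := is_derive_sqnorm VC x1 0 e1 xe.
  rewrite great_circle0 sin0 cos0 oppr0 scale0r scale1r add0r -mulr_sumr.
  by have [-> _] := max_conditions VC Vsym Veuler x1 xmax e1 xe; rewrite mulr0.
have dphi := is_derive_along0 x1 e1 xe phiC.
have gc0 : gc 0 = x by exact: great_circle0.
have S0 : 0 < 1 + sqnorm V x by rewrite ltr_wpDr.
have d1 := @is_derive_powR_comp _ (hom0 u \o gc) _ alpha 0 _ dU.
have d2 := @is_derive_powR_comp _ (fun t => 1 + (sqnorm V \o gc) t) _ beta 0 _
  (is_derive_add (is_derive_cst_fun 0 1) dS).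
rewrite /= gc0 in d1 d2.
apply: is_derive_eq (is_derive_mul (is_derive_mul (d1 (U_gt0 Dx)) (d2 S0)) dphi) _.
rewrite /rho /= gc0 great_circle0 (hom0_sphere phi xs); have := phi0 xs; have := U_gt0 Dx.
move: (hom0 u x) (phi x) (pdiff _ _ _) (1 + _) S0 (_ `^ alpha) => a c d s s0 w a0 c0.
move: (s `^ beta) => v.
by field; rewrite !gt_eqF.
Qed.

(** [rho t] is the quotient at the eigenvalues of [A t], hence for small t > 0 at most its value
    [h (eps * t)] at those of [A 0] shifted by [eps * t]. As [rho 0 = h 0],
    [derivative_le0_of_dominated] applies, and the positive factor [rho 0] is divided out. *)
Lemma rho_derivative_le0 : alpha * b + pdiff (hom0 phi) x e / phi x <= 0.
Proof.
have [E Efr] := tframe_exists x1.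
pose A t := frame_hessian V x E t + 1%:M.
have eig t : exists lam : 'I_n -> R, [/\ eigen_list (A t) lam, inGammaLambda P k lam &
    sigmaLambda P k lam / sigmaLambda P l lam = rho t].
  by apply: normalized_equation => //; exact: tframe_rotated.
have [lam0 [el0 G0 F0]] := eig 0.
pose h s := sigmaLambda P k (fun i => lam0 i + s) / sigmaLambda P l (fun i => lam0 i + s).
have lam00 : (fun i => lam0 i + 0) = lam0 by apply/funext => i; rewrite addr0.
have sl0 : 0 < sigmaLambda P l lam0 by exact: sigmaLambda_gt0 G0 (ltnW lk).
have dh : derivable h 0 1.
  apply: derivableM; first exact: derivable_sigmaLambda_shift.
  by apply: derivableV; [rewrite lam00 gt_eqF | exact: derivable_sigmaLambda_shift].
have AT t : (A t)^T = A t.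
  rewrite /A [(_ + _)^T]raddfD/= trmx1 /frame_hessian !trmx_mul trmxK mulmxA.
  congr (_ *m _ *m _ + _); apply/matrixP => i j; rewrite !mxE.
  by rewrite Vsym; [rewrite mulrC | exact/sphere_neq0/gcs].
have rho0 : rho 0 = h 0 by rewrite /h lam00.
have := derivative_le0_of_dominated is_derive_rho (derivableP dh) rho0.
have rp : 0 < rho 0.
  by rewrite -F0 divr_gt0//; exact: sigmaLambda_gt0 G0 (leqnn k).
rewrite pmulr_rle0//; apply => eps eps0.
have N := form_le_of_derive
  (is_derive_frame_hessian VC Vsym Veuler x1 xmax Efr xpos)
  (frame_hessian_derivative_le0 VC Vsym Veuler x1 xmax Efr xpos) eps0.
apply: filterS N => t Hz.
have [lam [el G <-]] := eig t.
(* The factor [1] puts [B] in the form required by [eigen_list_affine]. *)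
pose B := 1 *: A 0 + (eps * t)%:M.
have elB := eigen_list_affine (eps * t) (oner_neq0 R) el0.
have BT : B^T = B by rewrite /B [(_ + _)^T]raddfD/= linearZ/= AT tr_scalar_mx.
have [z|s le] := weyl_monotone (AT t) BT el elB.
  rewrite /B /A scale1r !mulmxDr !mulmxDl !mul_mx_scalar -!scalemxAl !scale1r.
  have := Hz z; rewrite (edot_mulmx z z).
  move: (z *m frame_hessian V x E t *m z^T) (z *m frame_hessian V x E 0 *m z^T).
  move: (z *m z^T) => M1 M2 M3; rewrite !mxE; lra.
apply: sigmaLambda_quotient_mono (ltnW lk) G _ => i.
by have := le i; rewrite mul1r; apply.
Qed.

(** By Cauchy-Schwarz the derivative of [phi] along the unit vector [e] is at least minus the norm
    of its gradient. *)
Lemma log_gradient_max_le (M : R) : sgradnorm phi x / phi x <= M -> alpha * b <= M.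
Proof.
apply: le_trans; have := rho_derivative_le0; have ph := phi0 xs.
rewrite pdiff_edot -/(sgrad phi x) -lerBrDr sub0r => /le_trans; apply.
rewrite -mulNr ler_pM2r ?invr_gt0// /sgradnorm.
apply: le_trans (ler_norm _) _; rewrite normrN -sqrtr_sqr ler_wsqrtr//.
exact: edot_unit_le.
Qed.

End GradientEstimate.

Theorem theorem4p2 (R : realType) (n P k l : nat) (p q : R)
    (u phi : 'rV[R]_n.+1 -> R) :
  (2 <= n)%N -> (1 < P)%N -> (P <= n - 1)%N ->
  (l < k)%N -> (k <= 'C(n, P))%N ->
  q - l%:R < p ->
  CkS 1 phi -> (forall x, sphere x -> 0 < phi x) ->
  CkS 3 u -> (forall x, sphere x -> 0 < u x) ->
  (forall x, sphere x -> forall E, tframe x E ->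
     exists lam : 'I_n -> R,
       eigen_list (sW u x E) lam /\
       inGammaLambda P k lam /\
       sigmaLambda P k lam / sigmaLambda P l lam =
         u x `^ (p - 1) *
         (u x ^+ 2 + sgradnorm u x ^+ 2) `^ ((k%:R + 1 - q) / 2) * phi x) ->
  forall M : R,
    (forall y, sphere y -> sgradnorm phi y / phi y <= M) ->
  forall x, sphere x ->
    sgradnorm u x / u x <= (p - q + l%:R)^-1 * M.
Proof.
move=> _ _ _ lk _ pql phiC phi0 uC u0 equation M phiM x xs.
pose V := logpd (hom0 u).
have U0 y : punctured y -> hom0 u y != 0 by move=> Dy; rewrite gt_eqF// hom0_gt0.
have VC i : Ck 2 (@punctured R n) (V i) by apply: logpd_C2 => //; exact: punctured_open.
have [y ys ymax] : exists2 y, sphere y & forall z, sphere z -> sqnorm V z <= sqnorm V y.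
  have [||y] := @EVT_max_rV R n.+1 (sqnorm V) (@sphere R n) _ (@sphere_compact R n).
  - by exists x.
  - apply: continuous_in_subspaceT => y; rewrite inE => /sphere_neq0 Dy.
    apply: differentiable_continuous; have -> : sqnorm V = \sum_i (V i * V i).
      by apply/funext => z; rewrite fct_sumE; apply: eq_bigr => i _; rewrite expr2.
    apply: differentiable_sum => i.
    have [dV _] := C1_differentiable (@punctured_open R n) Dy (CkW (VC i)).
    exact: differentiableM.
  by rewrite inE => ys ymax; exists y => // z zs; apply: ymax; rewrite inE.
have a0 : 0 < p - q + l%:R by lra.
have gradE : sgradnorm u x / u x = Num.sqrt (sqnorm V x).
  have ux := u0 x xs.
  rewrite -[LHS]ger0_norm ?divr_ge0 ?enorm_ge0 ?ltW// -sqrtr_sqr expr_div_n.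
  by rewrite (sgradnorm_sqnorm u0 xs) [u x ^+ 2 * _]mulrC mulfK// expf_neq0// gt_eqF.
rewrite gradE; apply: le_trans (ler_wsqrtr (ymax x xs)) _.
rewrite ler_pdivlMl//.
(* If the maximum is zero, the gradient gives no direction to follow; the left side is then zero,
   and [M] is nonnegative because it bounds a nonnegative ratio. *)
have [s0|sy] := leP (sqnorm V y) 0.
  rewrite (ler0_sqrtr s0) mulr0; apply: le_trans (phiM y ys).
  by rewrite divr_ge0 ?enorm_ge0// ltW// phi0.
exact: (log_gradient_max_le lk phiC phi0 uC u0 equation ys ymax sy (phiM y ys)).
Qed.
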